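(* Let $(X,\mathcal{A},\mu,T)$ be a measure preserving system with super-polynomial decay of correlations, and let $f:X\to\mathbb{R}^N$ be a Lipschitz observation such that the system is $\mu$-almost aperiodic for $f$. Assume Hypothesis (I) holds. Then for every $t\ge 0$ and for $\mu$-almost every $x_0\in X$ such that $\underline{d}_{f_*\mu}(f(x_0))>0$: \[\lim_{r\to0}\mu\left(x\in X:\ \tau_r^f(x,x_0)>\frac{t}{f_*\mu\left(B(f(x_0),r)\right)}\right)=e^{-t}\] and \[\lim_{r\to0}\mu_{f^{-1}B(f(x_0),r)}\left(x\in X:\ \tau_r^f(x,x_0)>\frac{t}{f_*\mu\left(B(f(x_0),r)\right)}\right)=e^{-t}.\]
   Context: A measure preserving system (m.p.s.) $(X,\mathcal{A},\mu,T)$: $X$ is a metric space, $\mathcal{A}$ its Borel $\sigma$-algebra, $\mu$ a Borel probability measure, $T:X\to X$ measurable with $\mu(T^{-1}A)=\mu(A)$ for all $A\in\mathcal{A}$. An observation is a measurable map $f:X\to\mathbb{R}^N$; $B(y,r)$ denotes the open ball of radius $r$ centered at $y$; $f_*\mu(\cdot)=\mu(f^{-1}(\cdot))$ is the pushforward measure; for a set $A$ of positive measure, $\mu_A(B)=\mu(A\cap B)/\mu(A)$ is the conditional measure. For $x,x_0\in X$ and $r>0$, the hitting time for the observation is $\tau_r^f(x,x_0)=\inf\{k\in\mathbb{N}^*: f(T^kx)\in B(f(x_0),r)\}$. The system is $\mu$-almost aperiodic for $f$ if $\mu(\{x\in X:\exists n\in\mathbb{N}^*,\ f(T^nx)=f(x)\})=0$.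 Lower pointwise dimension of a Borel probability measure $\nu$ at $y$: $\underline{d}_\nu(y)=\liminf_{r\to0}\frac{\log\nu(B(y,r))}{\log r}$. Super-polynomial decay of correlations: there is a sequence $(\theta_n)$ with $\lim_{n\to\infty}\theta_n n^p=0$ for every $p>0$ such that for every Lipschitz $\psi:X\to\mathbb{R}$, every bounded measurable $\phi:X\to\mathbb{R}$ and every $n\in\mathbb{N}^*$, $\left|\int\psi\cdot\phi\circ T^n\,d\mu-\int\psi\,d\mu\int\phi\,d\mu\right|\le\|\psi\|_{Lip}\|\phi\|_\infty\theta_n$, where $\|\psi\|_{Lip}$ is the Lipschitz constant of $\psi$. Hypothesis (I): for $f_*\mu$-almost every $y\in\mathbb{R}^N$ there exist $a>0$ and $b\ge0$ such that $f_*\mu\left(B(y,r)\setminus B(y,r-\rho)\right)\le r^{-b}\rho^a$ for every sufficiently small $r>0$ and every $0<\rho<r$. *)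

(* Defs.v *)
From HB Require Import structures.
From mathcomp Require Import all_boot all_order all_algebra.
From mathcomp Require Import all_classical all_reals all_analysis.
Set Implicit Arguments.
Unset Strict Implicit.
Unset Printing Implicit Defensive.
Import Order.TTheory GRing.Theory Num.Theory.
Import numFieldNormedType.Exports.
Local Open Scope classical_set_scope.
Local Open Scope ring_scope.

Section Defs.
Variable R : realType.

Definition is_metric (X : Type) (dX : X -> X -> R) : Prop :=
  [/\ forall x y, 0 <= dX x y,
      forall x y, dX x y = 0 <-> x = y,
      forall x y, dX x y = dX y x &
      forall x y z, dX x z <= dX x y + dX y z].

Definition dopen (X : Type) (dX : X -> X -> R) (A : set X) : Prop :=
  forall x, A x -> exists2 e : R, 0 < e & forall y, dX x y < e -> A y.

Definition is_borel_of (d : measure_display) (X : measurableType d)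
  (dX : X -> X -> R) : Prop := @measurable d X = <<s dopen dX >>.

Definition enorm (N : nat) (v : 'rV[R]_N) : R :=
  Num.sqrt (\sum_(i < N) v ord0 i ^+ 2).

Definition eball (N : nat) (y : 'rV[R]_N) (r : R) : set 'rV[R]_N :=
  [set z | enorm (z - y) < r].

Definition eopen (N : nat) (A : set 'rV[R]_N) : Prop :=
  forall y, A y -> exists2 e : R, 0 < e & eball y e `<=` A.

Definition eborel (N : nat) : set (set 'rV[R]_N) := <<s @eopen N >>.

Definition lipschitz_to_RN (X : Type) (dX : X -> X -> R) (N : nat)
  (f : X -> 'rV[R]_N) : Prop :=
  exists L : R, forall x y, enorm (f x - f y) <= L * dX x y.

Definition lipschitz_real (X : Type) (dX : X -> X -> R) (psi : X -> R) : Prop :=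
  exists L : R, forall x y, `|psi x - psi y| <= L * dX x y.

Definition lip_const (X : Type) (dX : X -> X -> R) (psi : X -> R) : R :=
  sup [set `|psi p.1 - psi p.2| / dX p.1 p.2 | p in [set p : X * X | p.1 <> p.2]].

Definition sup_norm (X : Type) (phi : X -> R) : R :=
  sup [set `|phi x| | x in [set: X]].

Definition bounded_fun (X : Type) (phi : X -> R) : Prop :=
  exists M : R, forall x, `|phi x| <= M.

Section Measure.
Context {d : measure_display} {X : measurableType d}.
Local Open Scope ereal_scope.

Definition measure_preserving (mu : probability X R) (T : X -> X) : Prop :=
  measurable_fun setT T /\
  forall A, measurable A -> mu (T @^-1` A) = mu A.

Definition superpoly_decay (dX : X -> X -> R) (mu : probability X R)
  (T : X -> X) : Prop :=
  exists theta : nat -> R,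
    (forall p : R, (0 < p)%R ->
       (fun n : nat => theta n * (n%:R `^ p))%R @ \oo --> (0%R : R)) /\
    forall (psi phi : X -> R) (n : nat),
      lipschitz_real dX psi ->
      mu.-integrable setT (EFin \o psi) ->
      measurable_fun setT phi -> bounded_fun phi ->
      (0 < n)%N ->
      (`| fine (\int[mu]_x (psi x * phi (iter n T x))%:E)
          - fine (\int[mu]_x (psi x)%:E) * fine (\int[mu]_x (phi x)%:E) |
        <= lip_const dX psi * sup_norm phi * theta n)%R.

Definition push (N : nat) (mu : probability X R) (f : X -> 'rV[R]_N)
  (A : set 'rV[R]_N) : R := fine (mu (f @^-1` A)).

Definition almost_aperiodic (N : nat) (mu : probability X R) (T : X -> X)
  (f : X -> 'rV[R]_N) : Prop :=
  mu [set x | exists n : nat, (0 < n)%N /\ f (iter n T x) = f x] = 0.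

Definition push_ae (N : nat) (mu : probability X R) (f : X -> 'rV[R]_N)
  (P : 'rV[R]_N -> Prop) : Prop :=
  exists E : set 'rV[R]_N, eborel E /\ mu (f @^-1` E) = 0 /\
    forall y, ~ E y -> P y.

Definition hypothesis_I (N : nat) (mu : probability X R) (f : X -> 'rV[R]_N)
  : Prop :=
  push_ae mu f (fun y => exists a b : R, (0 < a)%R /\ (0 <= b)%R /\
    exists2 r0 : R, (0 < r0)%R & forall r rho : R, (0 < r < r0)%R ->
      (0 < rho < r)%R ->
      (push mu f (eball y r `\` eball y (r - rho)) <= r `^ (- b) * rho `^ a)%R).

(* lower pointwise dimension of f_* mu at y (log 0 = -oo convention) *)
Definition lower_dim (N : nat) (mu : probability X R) (f : X -> 'rV[R]_N)
  (y : 'rV[R]_N) : \bar R :=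
  limf_einf (fun r : R => if push mu f (eball y r) == 0%R then +oo
                          else ((ln (push mu f (eball y r))) / ln r)%:E)
            (0%R^'+).

(* hitting time tau_r^f(x, x0), valued in \bar R (+oo if never hit) *)
Definition hit_time (N : nat) (T : X -> X) (f : X -> 'rV[R]_N) (r : R)
  (x x0 : X) : \bar R :=
  ereal_inf [set (k%:R)%:E | k in [set k : nat | (0 < k)%N /\
                                 eball (f x0) r (f (iter k T x))]].

Definition cond_meas (mu : probability X R) (A B : set X) : R :=
  (fine (mu (A `&` B)) / fine (mu A))%R.
End Measure.
End Defs.

(* Main.v *)
Require Import Defs.
From HB Require Import structures.
From mathcomp Require Import all_boot all_order all_algebra.
From mathcomp Require Import all_classical all_reals all_analysis.
From mathcomp Require Import measurable_realfun ring lra zify.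
Import Order.TTheory GRing.Theory Num.Theory.
Import numFieldNormedType.Exports.
Local Open Scope classical_set_scope.
Local Open Scope ring_scope.
Set Implicit Arguments.
Unset Strict Implicit.
Unset Printing Implicit Defensive.

(* Let A be the preimage of B(f(x0), r), m its measure and S_k the set of points
   that avoid A at the times 1, ..., k. Invariance gives
   mu(S_(k+1)) = mu(S_k) - mu(A /\ S_k), so if |mu(A /\ S_k) - m mu(S_k)| <= e m
   for all k, then |mu(S_k) - (1 - m)^k| <= e for all k; with k = t/m both limits
   follow. The decorrelation of A and S_k is obtained by waiting a time n that is
   a power of 1/r: mixing, applied to a Lipschitz approximation of the indicator
   of A, handles the times after n (Hypothesis (I) controls the annulus), n m
   tends to 0 because the local dimension is positive, and what remains is to show
   that few points of A return to A before time n.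

   A return to A at time k forces |f(T^k x) - f(x)| < 2 r <= k^(-2D). By mixing
   and a covering argument, the points x that satisfy this and lie in a region of
   small measure have measure O(1/k^2), and aperiodicity takes care of each fixed
   k. So all fast returns lie in a fixed set H of arbitrarily small measure, and
   the density of H in A is small for almost every x0 by the weak-type inequality
   for the centred maximal function, which holds for arbitrary measures on R^N by
   a Besicovitch covering argument. *)

(** * Euclidean geometry *)

Section EuclideanNorm.
Context {R : realType} {N : nat}.
Implicit Types u v w : 'rV[R]_N.

Lemma enorm_ge0 u : 0 <= enorm u. Proof. exact: sqrtr_ge0. Qed.

Lemma sqr_enorm u : enorm u ^+ 2 = \sum_(i < N) u ord0 i ^+ 2.
Proof. by rewrite sqr_sqrtr// sumr_ge0// => i _; rewrite sqr_ge0. Qed.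

Definition edot u v : R := \sum_(i < N) u ord0 i * v ord0 i.

Lemma sqr_enormB u v : enorm (u - v) ^+ 2 =
  enorm u ^+ 2 + enorm v ^+ 2 - 2 * edot u v.
Proof.
rewrite !sqr_enorm /edot mulr_sumr -big_split/= -sumrB.
by apply: eq_bigr => i _; rewrite !mxE; ring.
Qed.

Lemma edotZ a u v : edot u (a *: v) = a * edot u v.
Proof. by rewrite /edot mulr_sumr; apply: eq_bigr => i _; rewrite mxE; ring. Qed.

Lemma edotC u v : edot u v = edot v u.
Proof. by apply: eq_bigr => i _; rewrite mulrC. Qed.

Lemma enormZ a u : enorm (a *: u) = `|a| * enorm u.
Proof.
apply/eqP; rewrite -(@eqrXn2 _ 2)// ?mulr_ge0 ?enorm_ge0//; apply/eqP.
rewrite exprMn !sqr_enorm real_normK ?num_real// mulr_sumr.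
by apply: eq_bigr => i _; rewrite mxE; ring.
Qed.

Lemma enormN u : enorm (- u) = enorm u.
Proof. by rewrite -scaleN1r enormZ normrN normr1 mul1r. Qed.

Lemma enorm_distC u v : enorm (u - v) = enorm (v - u).
Proof. by rewrite -opprB enormN. Qed.

Lemma coord_le_enorm u i : `|u ord0 i| <= enorm u.
Proof.
rewrite -(@ler_pXn2r _ 2)// ?nnegrE ?enorm_ge0// sqr_enorm real_normK ?num_real//.
by rewrite (bigD1 i)//= lerDl sumr_ge0// => j _; rewrite sqr_ge0.
Qed.

Lemma enorm0_eq0 u : enorm u = 0 -> u = 0.
Proof.
move=> u0; apply/rowP => i; rewrite mxE; apply/eqP.
by have := coord_le_enorm u i; rewrite u0 normr_le0.
Qed.

Lemma edot_le u v : edot u v <= enorm u * enorm v.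
Proof.
have [u0|u0] := eqVneq (enorm u) 0.
  rewrite u0 (enorm0_eq0 u0) mul0r /edot big1// => i _.
  by rewrite mxE mul0r.
have [v0|v0] := eqVneq (enorm v) 0.
  rewrite v0 (enorm0_eq0 v0) mulr0 /edot big1// => i _.
  by rewrite mxE mulr0.
have up : 0 < enorm u by rewrite lt_def u0 enorm_ge0.
have vp : 0 < enorm v by rewrite lt_def v0 enorm_ge0.
(* The expansion of this square is 2ab(ab - c), with a, b the norms and c the inner product. *)
have := sqr_ge0 (enorm (enorm v *: u - enorm u *: v)).
rewrite sqr_enormB !enormZ edotZ (edotC (enorm v *: u)) edotZ (edotC v u) !ger0_norm ?enorm_ge0//.
set a := enorm u; set b := enorm v; set c := edot u v => h.
rewrite -subr_ge0 -(@pmulr_rge0 _ (2 * (a * b))); first by nra.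
by rewrite mulr_gt0// mulr_gt0.
Qed.

Lemma enormD u v : enorm (u + v) <= enorm u + enorm v.
Proof.
rewrite -(@ler_pXn2r _ 2)// ?nnegrE ?addr_ge0 ?enorm_ge0//.
rewrite -{1}(opprK v) sqr_enormB enormN -[- v]scaleN1r edotZ.
have := edot_le u v; nra.
Qed.

Lemma enorm_tri v u w : enorm (u - w) <= enorm (u - v) + enorm (v - w).
Proof. by rewrite -(subrKA v) enormD. Qed.

End EuclideanNorm.

(** * Grid cells and packing bounds *)

Section Packing.
Context {R : realType} {N : nat}.
Implicit Types u v w : 'rV[R]_N.

(** Cells have side [e / n.+1], with [n] the dimension: as n < (n+1)^2, their diameter stays below
    [e], also for n = 0. *)
Definition grid_size (n : nat) (K e : R) : nat := Num.trunc (2 * K * n.+1%:R / e).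

Definition grid_cell (K e : R) u : {ffun 'I_N -> 'I_(grid_size N K e).+1} :=
  [ffun i => inord (Num.trunc ((u ord0 i + K) * N.+1%:R / e))].

Lemma grid_cell_close (K e : R) u v : 0 < e -> enorm u <= K -> enorm v <= K ->
  grid_cell K e u = grid_cell K e v -> enorm (u - v) < e.
Proof.
move=> e0 uK vK /ffunP uv.
have K0 : 0 <= K by apply: le_trans uK; exact: enorm_ge0.
have N0 : 0 < N.+1%:R :> R by rewrite ltr0n.
have hc w i : enorm w <= K -> 0 <= (w ord0 i + K) * N.+1%:R / e /\
    (Num.trunc ((w ord0 i + K) * N.+1%:R / e) <= grid_size N K e)%N.
  move=> wK; have := le_trans (coord_le_enorm w i) wK.
  rewrite ler_norml => /andP[w1 w2]; split.
    by rewrite divr_ge0 ?mulr_ge0// ?(ltW e0)//; lra.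
  apply: le_truncn; rewrite ler_pM2r ?invr_gt0// ler_pM2r//; lra.
have h i : `|(u - v) ord0 i| <= e / N.+1%:R.
  have := uv i; rewrite !ffunE => /(congr1 val)/=.
  have [u0 ul] := hc u i uK; have [v0 vl] := hc v i vK.
  rewrite !inordK ?ltnS// => E.
  have /andP[u1 u2] := truncn_itv u0; have /andP[v1 v2] := truncn_itv v0.
  have -> : (u - v) ord0 i = ((u ord0 i + K) * N.+1%:R / e -
     (v ord0 i + K) * N.+1%:R / e) * (e / N.+1%:R).
    by rewrite !mxE; field; rewrite (gt_eqF e0) nat1r pnatr_eq0.
  rewrite normrM (ger0_norm (ltW (divr_gt0 e0 N0))) ler_piMl ?(ltW (divr_gt0 e0 N0))//.
  move: u1 u2 v1 v2; rewrite E -natr1 ler_norml; lra.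
rewrite -(@ltr_pXn2r _ 2)// ?nnegrE ?enorm_ge0 ?(ltW e0)// sqr_enorm.
apply: (@le_lt_trans _ _ (\sum_(i < N) (e / N.+1%:R) ^+ 2)).
  apply: ler_sum => i _; rewrite -[leLHS]real_normK ?num_real//.
  by rewrite ler_pXn2r// nnegrE// divr_ge0// ltW.
rewrite sumr_const card_ord -[ltLHS]mulr_natr expr_div_n mulrAC.
rewrite ltr_pdivrMr ?exprn_gt0// ltr_pM2l ?exprn_gt0//.
by rewrite -natrX ltr_nat; lia.
Qed.

Lemma pairwise_cells (T : Type) (J : finType) (c : T -> J) (s : seq T) :
  pairwise (fun x y => c x != c y) s -> (size s <= #|J|)%N.
Proof.
move=> p; have : uniq (map c s) by rewrite uniq_pairwise pairwise_map.
by move=> /card_uniqP; rewrite size_map => <-; apply: max_card.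
Qed.

Lemma packing (T : Type) (g : T -> 'rV[R]_N) (z : 'rV[R]_N) (K e : R) (s : seq T) :
  0 < e -> all (fun x => enorm (g x - z) <= K) s ->
  pairwise (fun x y => e <= enorm (g y - g x)) s ->
  (size s <= (grid_size N K e).+1 ^ N)%N.
Proof.
move=> e0 sK sp.
rewrite (_ : (_ ^ N)%N = #|{ffun 'I_N -> 'I_(grid_size N K e).+1}|); last first.
  by rewrite card_ffun !card_ord.
apply: (@pairwise_cells _ _ (fun x => grid_cell K e (g x - z))).
apply: sub_in_pairwise sK sp => x y xK yK exy.
apply: contraL exy => /eqP/(grid_cell_close e0 xK yK).
by rewrite opprB addrA subrK -ltNge enorm_distC.
Qed.

End Packing.

(** * Besicovitch covering *)

Section Besicovitch.
Context {R : realType} {N : nat}.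
Implicit Types u v w : 'rV[R]_N.

(** Unit vectors in one cell are at distance below 1, so each cell spans a narrow cone. The zero
    vector stays at zero, the inverse of 0 being 0. *)
Definition direction u : {ffun 'I_N -> 'I_(grid_size N (1 : R) 1).+1} :=
  grid_cell (1 : R) 1 ((enorm u)^-1 *: u).

(* Vectors in a common cone make an angle of at most 60 degrees. *)
Lemma direction_close u v : direction u = direction v ->
  enorm (u - v) <= Num.max (enorm u) (enorm v).
Proof.
have n1 w : enorm ((enorm w)^-1 *: w) <= 1.
  rewrite enormZ ger0_norm ?invr_ge0 ?enorm_ge0//.
  by have [->|w0] := eqVneq (enorm w) 0; rewrite ?mulr0// mulVf.
move=> /(grid_cell_close ltr01 (n1 u) (n1 v)).
have [/enorm0_eq0 ->|u0] := eqVneq (enorm u) 0.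
  by rewrite sub0r enormN le_max lexx orbT.
have [/enorm0_eq0 ->|v0] := eqVneq (enorm v) 0.
  by rewrite subr0 le_max lexx.
have up : 0 < enorm u by rewrite lt_def u0 enorm_ge0.
have vp : 0 < enorm v by rewrite lt_def v0 enorm_ge0.
move=> h.
have {h} : enorm ((enorm u)^-1 *: u - (enorm v)^-1 *: v) ^+ 2 <= 1.
  by rewrite expr_le1// ?enorm_ge0// ltW.
rewrite sqr_enormB !enormZ edotZ edotC edotZ (edotC v) !ger0_norm ?invr_ge0 ?enorm_ge0//.
rewrite !mulVf// expr1n => h.
(* The squared distance of two unit vectors is 2 minus twice the cosine; being at most 1, it forces
   the cosine to be at least 1/2. *)
have h2 : enorm u * enorm v <= 2 * edot u v.
  rewrite -[leRHS](_ : (2 * ((enorm v)^-1 * ((enorm u)^-1 * edot u v))) *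
     (enorm u * enorm v) = _); last by field; rewrite u0 v0.
  by rewrite ler_peMl ?mulr_ge0 ?enorm_ge0//; lra.
rewrite -(@ler_pXn2r _ 2)// ?nnegrE ?enorm_ge0// ?le_max ?enorm_ge0//.
rewrite sqr_enormB; case: (leP (enorm u) (enorm v)) => uv; nra.
Qed.

(* Two balls of the family that contain z and lie in a common cone at z would
   have the centre of the smaller one inside the larger one. *)
Lemma bounded_overlap (T : Type) (g : T -> 'rV[R]_N) (rad : T -> R) (s : seq T) z :
  pairwise (fun x y => (rad x <= enorm (g y - g x)) && (rad y <= rad x)) s ->
  (count (fun x => (enorm (z - g x) < rad x)%R) s <=
     (grid_size N (1 : R) 1).+1 ^ N)%N.
Proof.
move=> sp; rewrite -size_filter.
rewrite (_ : (_ ^ N)%N = #|{ffun 'I_N -> 'I_(grid_size N (1 : R) 1).+1}|); last first.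
  by rewrite card_ffun !card_ord.
apply: (@pairwise_cells _ _ (fun x => direction (g x - z))).
have := filter_all (fun x => enorm (z - g x) < rad x) s.
move: (pairwise_filter (fun x => enorm (z - g x) < rad x) sp).
move=> h1 h2; apply: sub_in_pairwise h2 h1 => x y; rewrite !unfold_in => xz yz.
case/andP => xy yx; apply: contraTneq xy => /direction_close.
rewrite opprB addrA subrK -ltNge => h.
by rewrite enorm_distC (le_lt_trans h)// gt_max !(enorm_distC _ z) xz (lt_le_trans yz).
Qed.

(** On an infinite set the maximum is attained because the values come from a finite list, on which
    the induction runs. *)
Lemma exists_max_value (T : Type) (rad : T -> R) (rs : seq R) (U : set T) :
  U !=set0 -> (forall x, U x -> rad x \in rs) ->
  exists2 x, U x & forall y, U y -> rad y <= rad x.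
Proof.
elim: rs U => [|a rs IH] U [x0 Ux0] h; first by have := h _ Ux0.
have [[x1 [Ux1 ax1]]|none] := pselect (exists x, U x /\ a < rad x).
  have [|x [Ux ax] xm] := IH (U `&` [set x | a < rad x]) (ex_intro _ x1 (conj Ux1 ax1)).
    move=> x [Ux /= ax]; have := h _ Ux; rewrite inE => /orP[/eqP e|//].
    by move: ax; rewrite e ltxx.
  exists x => // y Uy; have [ay|ya] := ltP a (rad y); first exact: xm.
  exact: (le_trans ya (ltW ax)).
have le_a y : U y -> rad y <= a.
  by move=> Uy; rewrite leNgt; apply/negP => ay; apply: none; exists y.
have [[x1 [Ux1 ax1]]|none'] := pselect (exists x, U x /\ rad x = a).
  by exists x1 => // y Uy; rewrite ax1 le_a.
apply: IH; first by exists x0.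
move=> x Ux; have := h _ Ux; rewrite inE => /orP[/eqP e|//].
by exfalso; apply: none'; exists x.
Qed.

(* Greedy selection, always taking a largest admissible ball; it stops because
   the chosen centres are uniformly separated in a bounded region. *)
Lemma greedy_cover (T : choiceType) (g : T -> 'rV[R]_N) (rad : T -> R)
    (rs : seq R) (e K : R) (E : set T) :
  0 < e -> (forall x, E x -> rad x \in rs) -> (forall x, E x -> e <= rad x) ->
  (forall x, E x -> enorm (g x) <= K) ->
  exists s : seq T, [/\ forall x, x \in s -> E x,
    pairwise (fun x y => (rad x <= enorm (g y - g x)) && (rad y <= rad x)) s &
    forall x, E x -> exists2 p, p \in s & enorm (g x - g p) < rad p].
Proof.
move=> e0 Ers Ee EK.
pose unc (s : seq T) : set T := [set x | E x /\ forall p, p \in s -> rad p <= enorm (g x - g p)].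
(* The last clause keeps uncovered balls no larger than the chosen ones, so appending a largest of
   them preserves the order of the radii. *)
pose inv (s : seq T) := [/\ forall x, x \in s -> E x,
    pairwise (fun x y => (rad x <= enorm (g y - g x)) && (rad y <= rad x)) s &
    forall x p, unc s x -> p \in s -> rad x <= rad p].
(* Each round either finds nothing uncovered or lengthens the list. A list longer than the packing
   bound is impossible, so the first case must occur. *)
have ext n : exists s, inv s /\ (unc s = set0 \/ size s = n).
  elim: n => [|n [s [[sE sp sm] [s0|sn]]]].
  - by exists [::]; split; [split|right].
  - by exists s; split; [split|left].
  have [u0|/set0P une] := eqVneq (unc s) set0; first by exists s; split; [split|left].
  have [x [Ex xs] xmax] := exists_max_value une (fun x (h : unc s x) => Ers x h.1).
  exists (rcons s x); split; last by right; rewrite size_rcons sn.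
  split.
  - by move=> y; rewrite mem_rcons inE => /orP[/eqP ->|/sE].
  - rewrite pairwise_rcons sp andbT; apply/allP => p ps /=.
    by rewrite xs// sm.
  move=> y p [Ey ys]; have yu : unc s y.
    by split=> // q qs; apply: ys; rewrite mem_rcons inE qs orbT.
  rewrite mem_rcons inE => /orP[/eqP ->|]; first exact: xmax.
  exact: sm.
have [s [[sE sp sm]]] := ext ((grid_size N K e).+1 ^ N).+1.
case=> [s0|sn]; last first.
  have : (size s <= (grid_size N K e).+1 ^ N)%N.
    apply: (@packing _ _ _ g 0 K e s e0).
      by apply/allP => x xs; rewrite subr0; apply: EK; exact: sE.
    have sE' : all [in E] s by apply/allP => x /sE ?; rewrite inE.
    apply: sub_in_pairwise sE' sp => x y /set_mem/Ee ex _ /andP[h _].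
    exact: le_trans ex h.
  by rewrite sn ltnn.
exists s; split=> // x Ex; apply: contrapT => nx.
suff ux : unc s x by have : (set0 : set T) x by rewrite -s0.
split=> // p ps; rewrite leNgt; apply/negP => h; apply: nx; exists p => //.
Qed.

End Besicovitch.

(** * Outer estimates for probability measures *)

Section Probability.
Context {R : realType} {d : measure_display} {X : measurableType d}.
Variable mu : probability X R.
Implicit Types A B E H U : set X.

Definition pr A : R := fine (mu A).

Lemma prE A : measurable A -> mu A = (pr A)%:E.
Proof. by move=> mA; rewrite fineK// fin_num_measure. Qed.

Lemma pr_ge0 A : 0 <= pr A. Proof. exact/fine_ge0/measure_ge0. Qed.

Lemma pr_le A B : measurable A -> measurable B -> A `<=` B -> pr A <= pr B.
Proof.
by move=> mA mB AB; rewrite -lee_fin -!prE// le_measure// inE.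
Qed.

Lemma prT : pr setT = 1. Proof. by rewrite /pr probability_setT. Qed.

Lemma pr0 : pr set0 = 0. Proof. by rewrite /pr measure0. Qed.

Lemma pr_le1 A : measurable A -> pr A <= 1.
Proof. by move=> mA; rewrite -prT pr_le. Qed.

Lemma prDI A B : measurable A -> measurable B -> pr A = pr (A `\` B) + pr (A `&` B).
Proof.
move=> mA mB; apply: EFin_inj; rewrite EFinD -!prE//; last 2 first.
- exact: measurableI.
- exact: measurableD.
by rewrite (measureDI mu mA mB).
Qed.

Lemma prU_le A B : measurable A -> measurable B -> pr (A `|` B) <= pr A + pr B.
Proof.
move=> mA mB; have mU : measurable (A `|` B) by exact: measurableU.
rewrite (prDI mU mA) addrC; apply: lerD; apply: pr_le => //.
- exact: measurableI.
- exact: measurableD.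
- by move=> x [[]].
Qed.

Lemma prC A : measurable A -> pr (~` A) = 1 - pr A.
Proof.
by move=> mA; rewrite -prT (prDI measurableT mA) setTD setTI addrK.
Qed.

Lemma pr_bigU_le (T : Type) (s : seq T) (F : T -> set X) :
  (forall t, measurable (F t)) ->
  pr (\big[setU/set0]_(t <- s) F t) <= \sum_(t <- s) pr (F t).
Proof.
move=> mF; elim: s => [|t s IH]; first by rewrite !big_nil pr0.
rewrite !big_cons (le_trans (prU_le (mF t) _)) ?lerD2l//.
exact: bigsetU_measurable.
Qed.

(** Integrate over [H] the number of sets through x, which is at most [C]. *)
Lemma pr_overlap (T : Type) (s : seq T) (F : T -> set X) H (C : nat) :
  (forall t, measurable (F t)) -> measurable H ->
  (forall x, (count (fun t => `[< F t x >]) s <= C)%N) ->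
  \sum_(t <- s) pr (F t `&` H) <= C%:R * pr H.
Proof.
move=> mF mH hC; rewrite -lee_fin EFinM -prE// -sumEFin.
rewrite (eq_bigr (fun t => (\int[mu]_(x in H) (\1_(F t) x)%:E)%E)); last first.
  by move=> t _; rewrite integral_indic//; apply/esym/prE; exact: measurableI.
have mF1 t : measurable_fun H (fun x => (\1_(F t) x)%:E : \bar R).
  exact/measurable_EFinP/measurable_indic.
rewrite -ge0_integral_sum//.
have -> : (C%:R%:E * mu H = \int[mu]_(x in H) C%:R%:E)%E by rewrite integral_cst.
apply: ge0_le_integral => //.
- by move=> x _; apply: sume_ge0 => t _; rewrite lee_fin.
- by apply: emeasurable_sum.
move=> x Hx; rewrite sumEFin lee_fin.
apply: le_trans (_ : (count (fun t => `[< F t x >]) s)%:R <= _); last by rewrite ler_nat.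
elim: s {hC} => [|t s IH]; first by rewrite big_nil.
rewrite big_cons/= natrD lerD// indicE.
Qed.

Lemma pr_bigcup_nondecreasing (V : nat -> set X) (b : R) :
  (forall n, measurable (V n)) -> (forall m n, (m <= n)%N -> V m `<=` V n) ->
  (forall n, pr (V n) <= b) -> pr (\bigcup_n V n) <= b.
Proof.
move=> mV ndV hb.
have mU : measurable (\bigcup_n V n) by exact: bigcup_measurable.
have h := @nondecreasing_cvg_mu _ _ _ mu V mV mU _.
rewrite -lee_fin -prE//; apply: (@cvge_le _ _ _ _ _ (mu (\bigcup_n V n)) b%:E) (h _).
  by apply: nearW => n /=; rewrite prE// lee_fin.
by move=> m n mn; apply/subsetPset; exact: ndV.
Qed.

(* Stands for mu^*(E) <= b; the sets it is applied to need not be measurable. *)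
Definition outer_le E (b : R) :=
  exists U, [/\ measurable U, E `<=` U & pr U <= b].

Lemma outer_le_sub E E' b b' : E' `<=` E -> b <= b' -> outer_le E b -> outer_le E' b'.
Proof.
by move=> EE bb [U [mU EU Ub]]; exists U; split=> //; [exact: subset_trans EU|exact: le_trans bb].
Qed.

(** The covers need not be nested. Intersecting each with all later ones makes them so, and [E n]
    remains covered because the sets increase. *)
Lemma outer_le_bigcup_nondecreasing (E : nat -> set X) b :
  (forall m n, (m <= n)%N -> E m `<=` E n) ->
  (forall n, outer_le (E n) b) -> outer_le (\bigcup_n E n) b.
Proof.
move=> ndE /choice[U hU].
pose V n := \bigcap_(m in [set m | (n <= m)%N]) U m.
have mV n : measurable (V n) by apply: bigcap_measurable => [|m _]; [exists n => /=|have [] := hU m].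
exists (\bigcup_n V n); split; first exact: bigcup_measurable.
  move=> x [n _ Enx]; exists n => // m /= nm.
  by have [_ h _] := hU m; apply: h; exact: ndE Enx.
apply: pr_bigcup_nondecreasing => //.
  by move=> m n mn x h k /= nk; apply: h => /=; exact: leq_trans nk.
move=> n; have [mU _ le_b] := hU n.
by rewrite (le_trans _ le_b)// pr_le// => x; apply => /=.
Qed.

Lemma outer_le_negligible E :
  (forall e, 0 < e -> outer_le E e) -> mu.-negligible E.
Proof.
move=> h; have /choice[U hU] n := h _ (@harmonic_gt0 R n).
have mI : measurable (\bigcap_n U n).
  by apply: bigcap_measurable => [|n _]; [exists 0%N|have [] := hU n].
exists (\bigcap_n U n); split => //; last first.
  by move=> x Ex n _; have [_ + _] := hU n; apply.
rewrite prE//; congr (_%:E); apply/eqP; rewrite eq_le pr_ge0 andbT.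
apply/ler_addgt0Pl => e e0; rewrite addr0.
have [n ne] : exists n, harmonic n <= e :> R.
  have := @cvg_harmonic R; move/cvgrPdist_le => /(_ e e0)[n _ /(_ n (leqnn n))].
  by rewrite sub0r normrN ger0_norm ?harmonic_ge0//; exists n.
have [mU _ le_b] := hU n.
by rewrite (le_trans _ ne)// (le_trans _ le_b)// pr_le// => x; apply.
Qed.

(** Telescoping: 1/(k+1)^2 is at most 1/k - 1/(k+1). *)
Lemma inv_sqr_tail (q n : nat) :
  (0 < q)%N -> \sum_(q <= k < q + n) (k.+1%:R ^+ 2)^-1 <= q%:R^-1 :> R.
Proof.
move=> q0; apply: le_trans (_ : q%:R^-1 - (q + n)%:R^-1 <= _); last by rewrite gerBl invr_ge0.
elim: n => [|n IH]; first by rewrite addn0 big_geq// subrr.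
rewrite addnS big_nat_recr/= ?leq_addr//.
apply: le_trans (lerD IH (lexx _)) _.
have p0 : 0 < (q + n)%:R :> R by rewrite ltr0n; lia.
rewrite -natr1; move: ((q + n)%:R : R) p0 => a a0.
have -> : ((a + 1) ^+ 2)^-1 = a^-1 - (a + 1)^-1 - (a * (a + 1) ^+ 2)^-1.
  by field; rewrite !gt_eqF// addr_gt0.
have : 0 <= (a * (a + 1) ^+ 2)^-1 by rewrite invr_ge0 mulr_ge0 ?sqr_ge0// ltW.
lra.
Qed.

(** The covers are fixed before [e], so one sequence of measurable sets has small tails for every
    [e]. *)
Lemma outer_borel_cantelli (E : nat -> set X) C :
  (forall k, outer_le (E k) (C / k.+1%:R ^+ 2)) ->
  exists U : nat -> set X, [/\ forall k, measurable (U k), forall k, E k `<=` U k &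
    forall e, 0 < e -> exists q0, forall q, (q0 <= q)%N ->
      pr (\bigcup_(k in [set k | (q <= k)%N]) U k) <= e].
Proof.
move=> /choice[U hU].
have mU k : measurable (U k) by have [] := hU k.
have C0 : 0 <= C.
  have [_ _ h] := hU 0%N; have := le_trans (pr_ge0 _) h.
  by rewrite expr1n divr1.
exists U; split => //; first by move=> k; have [] := hU k.
move=> e e0; pose q0 := (Num.trunc (C / e)).+1.
exists q0 => q qq0.
have q_gt0 : (0 < q)%N by rewrite (leq_trans _ qq0).
have -> : \bigcup_(k in [set k | (q <= k)%N]) U k =
    \bigcup_n (\big[setU/set0]_(q <= k < q + n) U k).
  apply/seteqP; split=> [x [k /= qk Ux]|x [n _]].
    exists (k - q).+1 => //; rewrite -bigcup_seq; exists k => //=.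
    by rewrite mem_index_iota qk/=; lia.
  by rewrite -bigcup_seq => -[k /=]; rewrite mem_index_iota => /andP[qk _] Ux; exists k.
apply: pr_bigcup_nondecreasing.
- by move=> n; exact: bigsetU_measurable.
- move=> m n mn x; rewrite -!bigcup_seq => -[k /=]; rewrite mem_index_iota => /andP[qk km] Ux.
  by exists k => //=; rewrite mem_index_iota qk/= (leq_trans km)// leq_add2l.
move=> n; apply: le_trans (pr_bigU_le _ mU) _.
apply: le_trans (_ : C * \sum_(q <= k < q + n) (k.+1%:R ^+ 2)^-1 <= _).
  by rewrite mulr_sumr; apply: ler_sum => k _; have [] := hU k.
apply: le_trans (ler_wpM2l C0 (inv_sqr_tail n q_gt0)) _.
rewrite ler_pdivrMr ?ltr0n// mulrC -ler_pdivrMr//.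
apply: ltW; apply: lt_le_trans (_ : q0%:R <= _); last by rewrite ler_nat.
by rewrite truncnS_gt.
Qed.

End Probability.

(** * Tubes around the fibres of the observation *)

Section System.
Context {R : realType} {d : measure_display} {X : measurableType d}.
Variables (dX : X -> X -> R) (mu : probability X R) (T : X -> X) (N : nat).
Variable f : X -> 'rV[R]_N.
Hypothesis dX_metric : is_metric dX.
Hypothesis dX_borel : is_borel_of dX.

Local Notation P := (pr mu).

Lemma dopen_measurable (A : set X) : dopen dX A -> measurable A.
Proof. by move=> oA; rewrite dX_borel; exact: sub_sigma_algebra. Qed.

Lemma lipschitz_real_measurable (psi : X -> R) :
  lipschitz_real dX psi -> measurable_fun setT psi.
Proof.
move=> [L hL] _; apply: (measurability _ (RGenOInfty.measurableE R)) => // _ [_ [a ->] <-].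
rewrite setTI; apply: dopen_measurable => x /=.
rewrite in_itv/= andbT => ax.
have L0 : 0 < `|L| + 1 by rewrite ltr_wpDl.
exists ((psi x - a) / (`|L| + 1)); first by rewrite divr_gt0// subr_gt0.
move=> y; rewrite ltr_pdivlMr// => xy; rewrite in_itv/= andbT.
have dge0 : 0 <= dX x y by have [] := dX_metric.
have : psi x - psi y < psi x - a; last lra.
apply: le_lt_trans xy; apply: le_trans (ler_norm _) _; apply: le_trans (hL x y) _.
by rewrite mulrC ler_wpM2l// (le_trans (ler_norm _))// lerDl.
Qed.

Definition tube (y : 'rV[R]_N) (r : R) : set X := f @^-1` eball y r.

Lemma tube_le y r r' : r <= r' -> tube y r `<=` tube y r'.
Proof. by move=> rr x /= h; exact: lt_le_trans rr. Qed.

Hypothesis f_lipschitz : lipschitz_to_RN dX f.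

Lemma f_lipschitz_gt0 : exists2 L : R, 0 < L &
  forall x y, enorm (f x - f y) <= L * dX x y.
Proof.
have [L hL] := f_lipschitz; exists (`|L| + 1); first by rewrite ltr_wpDl.
move=> x y; apply: le_trans (hL x y) _; apply: ler_wpM2r; first by have [] := dX_metric.
by rewrite (le_trans (ler_norm _))// lerDl.
Qed.

Lemma enormB_lipschitz y x x' :
  `|enorm (f x - y) - enorm (f x' - y)| <= enorm (f x - f x').
Proof.
rewrite ler_norml lerBlDl lerNl opprB lerBlDr.
rewrite (le_trans (enorm_tri (f x) _ _)) ?(le_trans (enorm_tri (f x') _ _))//=.
- by rewrite addrC.
- by rewrite enorm_distC.
Qed.

Lemma dist_measurable y : measurable_fun setT (fun x => enorm (f x - y)).
Proof.
apply: lipschitz_real_measurable; have [L L0 hL] := f_lipschitz_gt0; exists L => x x'.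
exact: le_trans (enormB_lipschitz _ _ _) (hL _ _).
Qed.

Lemma coord_measurable i : measurable_fun setT (fun x => f x ord0 i).
Proof.
apply: lipschitz_real_measurable; have [L L0 hL] := f_lipschitz_gt0; exists L => x x'.
apply: le_trans (hL _ _); have := coord_le_enorm (f x - f x') i.
by rewrite !mxE.
Qed.

Lemma tube_measurable y r : measurable (tube y r).
Proof.
have := dist_measurable y measurableT (@measurable_itv R `]-oo, r[).
by rewrite setTI; congr measurable; apply/seteqP; split => x /=; rewrite in_itv.
Qed.

Hypothesis T_mp : measure_preserving mu T.

Lemma iter_measurable k : measurable_fun setT (iter k T).
Proof.
elim: k => [|k IH]; first exact: measurable_id.
by apply: (measurableT_comp (T_mp.1) IH).
Qed.

Lemma preim_iter_measurable k (A : set X) : measurable A -> measurable (iter k T @^-1` A).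
Proof. by move=> mA; rewrite -[X in measurable X]setTI; exact: iter_measurable. Qed.

Lemma pr_iter k (A : set X) : measurable A -> P (iter k T @^-1` A) = P A.
Proof.
move=> mA; elim: k => [//|k IH]; rewrite -[RHS]IH.
have -> : iter k.+1 T @^-1` A = T @^-1` (iter k T @^-1` A).
  by apply/seteqP; split=> x /=; rewrite -iterSr.
by rewrite /P /pr T_mp.2//; exact: preim_iter_measurable.
Qed.

(** Both points vary with x and T may be discontinuous, so the set need not be open; the squared
    distance is a sum of squares of measurable functions. *)
Lemma near_return_measurable k s :
  measurable [set x | enorm (f (iter k T x) - f x) < s].
Proof.
have [s0|s0] := leP s 0.
  rewrite (_ : mkset _ = set0)//; apply/seteqP; split=> // x /= /lt_le_trans/(_ s0).
  by rewrite ltNge enorm_ge0.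
have mS : measurable_fun setT
    (fun x => \sum_(i < N) (f (iter k T x) ord0 i - f x ord0 i) ^+ 2).
  apply: measurable_sum => i; apply: measurable_funX; apply: measurable_funB.
    exact: (measurableT_comp (coord_measurable i) (iter_measurable k)).
  exact: coord_measurable.
have := mS measurableT _ (@measurable_itv R `]-oo, s ^+ 2[).
rewrite setTI; congr measurable; apply/seteqP; split => x /=; rewrite in_itv/=;
  rewrite (_ : \sum_(i < N) _ = enorm (f (iter k T x) - f x) ^+ 2);
  rewrite ?ltr_pXn2r// ?nnegrE ?enorm_ge0// ?(ltW s0)// sqr_enorm;
  by apply: eq_bigr => i _; rewrite !mxE.
Qed.

(** * Lipschitz cutoffs and mixing for tubes *)

Lemma integral_sandwich (g : X -> R) (U U' : set X) :
  measurable_fun setT g -> measurable U -> measurable U' ->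
  (forall x, \1_U x <= g x <= \1_U' x) ->
  P U <= fine (\int[mu]_x (g x)%:E)%E <= P U'.
Proof.
move=> mg mU mU' h.
have g0 x : 0 <= g x by have /andP[+ _] := h x; apply: le_trans.
have muE A : measurable A -> mu A = (\int[mu]_x (\1_A x)%:E)%E.
  by move=> mA; rewrite integral_indic// setIT.
have mI (A : set X) : measurable A -> measurable_fun setT (fun x => (\1_A x)%:E : \bar R).
  by move=> mA; exact/measurable_EFinP/measurable_indic.
have mgE : measurable_fun setT (fun x => (g x)%:E) by exact/measurable_EFinP.
have h1 : (mu U <= \int[mu]_x (g x)%:E)%E.
  rewrite muE//; apply: ge0_le_integral => //; first exact: mI.
  by move=> x _; rewrite lee_fin; have /andP[] := h x.
have h2 : (\int[mu]_x (g x)%:E <= mu U')%E.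
  rewrite muE//; apply: ge0_le_integral => //.
  - by move=> x _; rewrite lee_fin.
  - exact: mI.
  - by move=> x _; rewrite lee_fin; have /andP[] := h x.
have fI : (\int[mu]_x (g x)%:E)%E \is a fin_num.
  rewrite ge0_fin_numE; first by rewrite (le_lt_trans h2)// ltey_eq fin_num_measure.
  by apply: integral_ge0 => x _; rewrite lee_fin.
by rewrite -!lee_fin !fineK ?fin_num_measure// h1.
Qed.

(** A Lipschitz substitute for the indicator of a tube, since mixing is assumed for a Lipschitz
    first factor; its Lipschitz constant is of order 1/(r - s). *)
Definition cutoff (y : 'rV[R]_N) (s r : R) (x : X) : R :=
  Num.max 0 (Num.min 1 ((r - enorm (f x - y)) / (r - s))).

Lemma cutoff_sandwich y s r x : s < r ->
  \1_(tube y s) x <= cutoff y s r x <= \1_(tube y r) x.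
Proof.
move=> sr; have rs : 0 < r - s by rewrite subr_gt0.
apply/andP; split; rewrite indicE /cutoff.
  case: (boolP (x \in tube y s)) => [/set_mem/= xs|_]; last by rewrite le_max lexx.
  by rewrite le_max le_min lexx/= ler_pdivlMr// mul1r lerD2l lerN2 (ltW xs) orbT.
case: (boolP (x \in tube y r)) => [_|/negP xr]; first by rewrite ge_max ge_min lexx ler01.
have {xr} : r <= enorm (f x - y).
  by rewrite leNgt; apply/negP => ?; apply: xr; apply/mem_set.
move=> xr; rewrite ge_max lexx/= ge_min; apply/orP; right.
by rewrite ler_pdivrMr// mul0r subr_le0.
Qed.

Lemma cutoff_lipschitz y s r L x x' : s < r ->
  (forall x y, enorm (f x - f y) <= L * dX x y) ->
  `|cutoff y s r x - cutoff y s r x'| <= L / (r - s) * dX x x'.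
Proof.
move=> sr hL; have rs : 0 < r - s by rewrite subr_gt0.
apply: le_trans (_ : `|enorm (f x - y) - enorm (f x' - y)| / (r - s) <= _); last first.
  rewrite mulrAC ler_pM2r ?invr_gt0//.
  exact: le_trans (enormB_lipschitz _ _ _) (hL _ _).
rewrite /cutoff -[X in _ <= _ * X]ger0_norm ?invr_ge0 ?(ltW rs)// -normrM.
have clamp (a b : R) : `|Num.max 0 (Num.min 1 a) - Num.max 0 (Num.min 1 b)| <= `|b - a|.
  have n1 := ler_norm (b - a); have n2 := ler_norm (- (b - a)).
  rewrite normrN in n2.
  case: (leP 1 a) => ha; case: (leP 1 b) => hb; case: (leP 0 a) => ha0;
    case: (leP 0 b) => hb0; case: (leP (0 : R) 1) => h01; rewrite ler_norml; lra.
apply: le_trans (clamp _ _) _.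
by rewrite le_eqVlt; apply/orP; left; apply/eqP; congr (`|_|); ring.
Qed.

Hypothesis decay : superpoly_decay dX mu T.

(* The rate already absorbs the Lipschitz constant of f. *)
Lemma decay_tubes : exists theta : nat -> R,
  (forall p : nat, exists C, forall n, (0 < n)%N -> theta n * n%:R ^+ p <= C) /\
  forall y s r (V : set X) n, s < r -> measurable V -> (0 < n)%N ->
    P (tube y s `&` iter n T @^-1` V) <= P (tube y r) * P V + theta n / (r - s) /\
    P (tube y s) * P V - theta n / (r - s) <= P (tube y r `&` iter n T @^-1` V).
Proof.
have [theta0 [th0 hdec]] := decay; have [L L0 hL] := f_lipschitz_gt0.
exists (fun n => L * `|theta0 n|); split.
  (* The decay hypothesis concerns positive exponents; [p.+1] also serves p = 0, and n^p is at most
     n^(p+1). *)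
  move=> p; have := th0 p.+1%:R (ltr0Sn _ _).
  move=> /cvgrPdist_le/(_ 1 ltr01)[n0 _ hn0].
  (* The 1 bounds the terms from [n0] on, the sum absorbs the finitely many earlier ones. *)
  exists (L * (1 + \sum_(i < n0) `|theta0 i| * i%:R ^+ p)) => n n_gt0.
  rewrite -mulrA ler_pM2l//.
  have S0 : 0 <= \sum_(i < n0) `|theta0 i| * i%:R ^+ p.
    by apply: sumr_ge0 => i _; rewrite mulr_ge0// exprn_ge0.
  have [n0n|nn0] := leqP n0 n.
    apply: le_trans (_ : 1 <= _); last by rewrite lerDl.
    have := hn0 n n0n; rewrite sub0r normrN normrM powR_mulrn//.
    rewrite [X in _ * X]ger0_norm ?exprn_ge0//; apply: le_trans.
    by rewrite ler_wpM2l// ler_weXn2l// ler1n.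
  rewrite (bigD1 (Ordinal nn0))//= addrCA lerDl addr_ge0//; apply: sumr_ge0 => i _.
  by rewrite mulr_ge0// exprn_ge0.
move=> y s r V n sr mV n0; have rs : 0 < r - s by rewrite subr_gt0.
have Llip : lipschitz_real dX (cutoff y s r).
  by exists (L / (r - s)) => x x'; exact: cutoff_lipschitz.
have mpsi := lipschitz_real_measurable Llip.
have mA q := tube_measurable y q.
have h1 : P (tube y s) <= fine (\int[mu]_x (cutoff y s r x)%:E)%E <= P (tube y r).
  by apply: integral_sandwich => // x; exact: cutoff_sandwich.
have mTV : measurable (iter n T @^-1` V) by exact: preim_iter_measurable.
have mV1 : measurable_fun setT (\1_V : X -> R) by exact: measurable_indic.
have h2 : P (tube y s `&` iter n T @^-1` V) <=
   fine (\int[mu]_x (cutoff y s r x * \1_V (iter n T x))%:E)%E <=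
   P (tube y r `&` iter n T @^-1` V).
  apply: integral_sandwich; [|exact: measurableI|exact: measurableI|].
    apply: measurable_funM => //.
    exact: (measurableT_comp mV1 (iter_measurable n)).
  move=> x; have /andP[c1 c2] := cutoff_sandwich y x sr.
  rewrite !indicI/= (_ : \1_(iter n T @^-1` V) x = \1_V (iter n T x) :> R)//.
  by rewrite !ler_wpM2r.
have h3 : P V <= fine (\int[mu]_x (\1_V x)%:E)%E <= P V.
  by apply: integral_sandwich => // x; rewrite lexx.
have E3 : fine (\int[mu]_x (\1_V x)%:E)%E = P V by apply/eqP; rewrite eq_le andbC.
have int_psi : mu.-integrable setT (EFin \o cutoff y s r).
  apply: measurable_bounded_integrable => //.
    by rewrite (le_lt_trans (probability_le1 _ _))// ltry.
  exists 1; split; first exact: num_real.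
  move=> M M1 x _ /=; rewrite (le_trans _ (ltW M1))//.
  have /andP[c1 c2] := cutoff_sandwich y x sr.
  rewrite ger0_norm; last by apply: le_trans c1.
  by rewrite (le_trans c2)// indicE; case: (_ \in _).
have ind1 x : `|\1_V x| <= 1 :> R.
  by rewrite indicE; case: (_ \in _); rewrite ?normr1 ?normr0.
have := hdec (cutoff y s r) (\1_V) n Llip int_psi _ _ n0.
move=> /(_ mV1 (ex_intro _ 1 ind1)).
rewrite E3.
(* The set of difference quotients is empty when X has a single point; [sup] is then 0 and the bound
   persists. *)
have sup_le (E : set R) (b : R) : 0 <= b -> (forall z, E z -> 0 <= z <= b) -> 0 <= sup E <= b.
  move=> b0 hE; have [->|/set0P [z Ez]] := eqVneq E set0; first by rewrite sup0 lexx.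
  have ubE : ubound E b by move=> w /hE/andP[].
  apply/andP; split; last by apply: ge_sup => //; exists z.
  have /andP[z0 _] := hE _ Ez; apply: le_trans z0 _.
  by apply: ub_le_sup => //; exists b.
have /andP[l0 l1] : 0 <= lip_const dX (cutoff y s r) <= L / (r - s).
  apply: sup_le; first by rewrite divr_ge0// ltW.
  move=> _ [[x x'] /= xx' <-].
  have [dge0 deq _ _] := dX_metric.
  have dp : 0 < dX x x' by rewrite lt_def dge0 andbT; apply/eqP => /deq.
  by rewrite divr_ge0//= ler_pdivrMr// cutoff_lipschitz.
have /andP[s0 s1] : 0 <= sup_norm (\1_V : X -> R) <= 1.
  by apply: sup_le => // _ [x _ <-]; rewrite normr_ge0 ind1.
have E4 : lip_const dX (cutoff y s r) * sup_norm (\1_V : X -> R) * theta0 n <=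
   L * `|theta0 n| / (r - s).
  rewrite [leRHS]mulrAC; apply: le_trans (ler_norm _) _; rewrite !normrM ler_wpM2r//.
  rewrite !ger0_norm//.
  by rewrite -[leRHS]mulr1 ler_pM.
move=> /le_trans/(_ E4); rewrite ler_norml => /andP[d1 d2].
have V0 : 0 <= P V by exact: pr_ge0.
move: h1 h2 => /andP[h1 h1'] /andP[h2 h2'].
have := ler_wpM2r V0 h1; have := ler_wpM2r V0 h1'.
by move=> *; split; lra.
Qed.

(** Continuity from above, through complements: if every [V n] had measure above [e], the union of
    the complements would have measure at most 1 - e instead of 1. *)
Lemma pr_bigcap_small (V : nat -> set X) (e : R) :
  (forall n, measurable (V n)) -> (forall m n, (m <= n)%N -> V n `<=` V m) ->
  P (\bigcap_n V n) = 0 -> 0 < e -> exists n, P (V n) <= e.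
Proof.
move=> mV niV h0 e0; apply: contrapT => none.
have mI : measurable (\bigcap_n V n) by apply: bigcap_measurable => //; exists 0%N.
have : P (\bigcup_n ~` V n) <= 1 - e.
  apply: pr_bigcup_nondecreasing.
  - by move=> n; exact: measurableC.
  - by move=> m n mn x h /(niV _ _ mn).
  move=> n; rewrite prC// lerD2l lerN2; apply: ltW; rewrite ltNge.
  by apply/negP => h; apply: none; exists n.
by rewrite -setC_bigcap prC// h0; lra.
Qed.

(** * The centred maximal function *)

Definition overlap_bound : nat := ((grid_size N (1 : R) 1).+1 ^ N)%N.

(** Choose around each bad point a ball where [H] is too dense and extract a greedy subcover. Each
    selected ball has measure at most 1/lam times that of its part in [H], and at most
    [overlap_bound] of them meet at a point. Finitely many radii and a bounded region make the
    selection possible. *)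
Lemma maximal_inequality_finite (rs : seq R) (K lam : R) (H : set X) :
  0 < lam -> measurable H -> (forall r, r \in rs -> 0 < r) ->
  outer_le mu [set x | enorm (f x) <= K /\
      exists2 r, r \in rs & lam * P (tube (f x) r) < P (tube (f x) r `&` H)]
    (overlap_bound%:R / lam * P H).
Proof.
move=> lam0 mH rs0; set E := mkset _.
have /choice[rad hrad] (x : X) : exists r, E x -> r \in rs /\
    lam * P (tube (f x) r) < P (tube (f x) r `&` H).
  have [[xK [r rrs hr]]|nE] := pselect (E x); first by exists r.
  by exists 0 => /nE.
have [e e0 he] : exists2 e, 0 < e & forall r, r \in rs -> e <= r.
  elim: rs rs0 {E rad hrad} => [_|r rs IH rs0]; first by exists 1.
  have [|e e0 he] := IH; first by move=> x xrs; apply: rs0; rewrite inE xrs orbT.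
  exists (Num.min r e); first by rewrite lt_min e0 rs0// mem_head.
  by move=> x; rewrite inE ge_min => /orP[/eqP->|/he ->]; rewrite ?lexx ?orbT.
have [s [sE sp sc]] := @greedy_cover R N X f rad rs e K E e0
  (fun x h => (hrad x h).1) (fun x h => he _ (hrad x h).1) (fun x h => h.1).
exists (\big[setU/set0]_(p <- s) tube (f p) (rad p)); split.
- by apply: bigsetU_measurable => p _; exact: tube_measurable.
- by move=> x /sc[p ps xp]; rewrite -bigcup_seq; exists p.
apply: le_trans (pr_bigU_le mu s (fun p => tube_measurable (f p) (rad p))) _.
apply: le_trans (_ : \sum_(p <- s) lam^-1 * P (tube (f p) (rad p) `&` H) <= _).
  rewrite !big_seq; apply: ler_sum => p /sE/hrad[_ h].
  by rewrite mulrC ler_pdivlMr// mulrC ltW.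
rewrite -mulr_sumr mulrAC mulrC ler_pM2r ?invr_gt0//.
apply: pr_overlap => //; first by move=> p; exact: tube_measurable.
move=> x; apply: leq_trans (bounded_overlap (f x) sp).
by apply: sub_count => p /asboolP.
Qed.

(* The weak-type bound for the maximal function of centred balls, for an
   arbitrary (possibly non-doubling) distribution of f. *)
Lemma maximal_inequality (lam : R) (H : set X) :
  0 < lam -> measurable H ->
  outer_le mu [set x | exists2 r, 0 < r &
      lam * P (tube (f x) r) < P (tube (f x) r `&` H)]
    (overlap_bound%:R / lam * P H).
Proof.
move=> lam0 mH.
(* The positive rationals among the first [n] codes; these lists exhaust the positive rationals. *)
pose rs n := [seq x <- pmap (fun i => omap (@ratr R) (unpickle i : option rat)) (iota 0 n) | 0 < x].
pose E n := [set x | enorm (f x) <= n%:R /\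
      exists2 r, r \in rs n & lam * P (tube (f x) r) < P (tube (f x) r `&` H)].
have rs_mono m n : (m <= n)%N -> {subset rs m <= rs n}.
  move=> mn x; rewrite !mem_filter !mem_pmap => /andP[-> /mapP[i]]/=.
  rewrite mem_iota => /andP[_ im] ->; apply: map_f; rewrite mem_iota/=; lia.
apply: (outer_le_sub _ (lexx _)); last first.
  apply: (@outer_le_bigcup_nondecreasing _ _ _ mu E) => [m n mn|n].
    move=> x [xm [r rm hr]]; split; first by rewrite (le_trans xm)// ler_nat.
    by exists r => //; exact: rs_mono rm.
  apply: maximal_inequality_finite => //.
  by move=> r; rewrite mem_filter => /andP[].
move=> x [r r0 hr].
(* For open balls the measure of the part in [H] is left continuous in the radius, so a bad radius
   can be lowered slightly to a rational one. *)
have [q q0 hq] : exists2 q : rat, 0 < ratr q :> R &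
    lam * P (tube (f x) (ratr q)) < P (tube (f x) (ratr q) `&` H).
  apply: contrapT => none.
  have : P (\bigcup_n (tube (f x) (r - r / n.+2%:R) `&` H)) <= lam * P (tube (f x) r).
    apply: pr_bigcup_nondecreasing.
    - by move=> n; apply: measurableI => //; exact: tube_measurable.
    - move=> m n mn z [zm zH]; split=> //; apply: tube_le zm.
      by rewrite lerD2l lerN2 ler_pM2l// lef_pV2 ?posrE// ler_nat.
    move=> n; have n2 : r - r / n.+2%:R < r by rewrite gtrBl divr_gt0.
    have [q] := rat_in_itvoo n2; rewrite in_itv/= => /andP[q1 q2].
    have q0 : 0 < ratr q :> R.
      apply: le_lt_trans q1; rewrite subr_ge0 ler_pdivrMr// ler_peMr ?(ltW r0)//.
      by rewrite ler1n.
    apply: le_trans (_ : P (tube (f x) (ratr q) `&` H) <= _).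
      apply: pr_le; [exact: measurableI (tube_measurable _ _) mH|
        exact: measurableI (tube_measurable _ _) mH|].
      by apply: setSI; apply: tube_le; exact: ltW.
    apply: le_trans (_ : lam * P (tube (f x) (ratr q)) <= _).
      by rewrite leNgt; apply/negP => h; apply: none; exists q.
    rewrite ler_pM2l//; apply: pr_le; [exact: tube_measurable|exact: tube_measurable|].
    by apply: tube_le; exact: ltW.
  suff -> : \bigcup_n (tube (f x) (r - r / n.+2%:R) `&` H) = tube (f x) r `&` H.
    by move=> h; have := lt_le_trans hr h; rewrite ltxx.
  apply/seteqP; split=> [z [n _ [zn zH]]|z [zr zH]].
    by split=> //; apply: tube_le zn; rewrite gerBl divr_ge0// ltW.
  have zr' : 0 < r - enorm (f z - f x) by rewrite subr_gt0.
  pose n := Num.trunc (r / (r - enorm (f z - f x))).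
  exists n => //; split=> //; rewrite /tube /eball/=.
  rewrite ltrBrDr -ltrBrDl ltr_pdivrMr// -ltr_pdivrMl//.
  rewrite mulrC; apply: lt_le_trans (truncnS_gt _) _.
  by rewrite ler_nat.
pose m := maxn (pickle q).+1 (Num.trunc (enorm (f x))).+1.
exists m => //; split.
  by apply: ltW; apply: lt_le_trans (truncnS_gt _) _; rewrite ler_nat leq_maxr.
exists (ratr q) => //; rewrite mem_filter q0/= mem_pmap; apply/mapP.
exists (pickle q); last by rewrite pickleK.
by rewrite mem_iota/= add0n leq_maxl.
Qed.

(** * Lower bounds for the measure of balls *)

Lemma separated_cover (E : set X) (K e : R) : 0 < e ->
  (forall x, E x -> enorm (f x) <= K) ->
  exists s : seq X, [/\ forall x, x \in s -> E x,
    pairwise (fun x y => e <= enorm (f y - f x)) s,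
    forall x, E x -> exists2 p, p \in s & enorm (f x - f p) < e &
    (size s <= (grid_size N K e).+1 ^ N)%N].
Proof.
move=> e0 EK.
have [s [sE sp sc]] := @greedy_cover R N X f (fun=> e) [:: e] e K E e0
  (fun x h => mem_head _ _) (fun x h => lexx _) EK.
have sp' : pairwise (fun x y => e <= enorm (f y - f x)) s.
  by apply: sub_pairwise sp => x y /andP[].
exists s; split=> //; apply: (@packing _ _ _ f 0 K e s e0) => //.
by apply/allP => x xs; rewrite subr0; apply: EK; exact: sE.
Qed.

Lemma grid_size_bound (K : nat) (e : R) : 0 < e -> e <= 1 ->
  (grid_size N K%:R e).+1%:R <= (2 * K%:R * N.+1%:R + 1) / e.
Proof.
move=> e0 e1; rewrite -natr1 mulrDl lerD//; last by rewrite mul1r invf_ge1.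
by have /truncn_itv/andP[] : 0 <= 2 * K%:R * N.+1%:R / e by rewrite divr_ge0// ltW.
Qed.

(** In a bounded region, O((j+1)^N) balls of radius 1/(j+1) cover the centres whose ball violates
    the bound. Each of these balls violates it too, so together they have measure O(1/(j+1)^2),
    which is summable. *)
Lemma ball_measure_lower_bound : {ae mu, forall x, exists j0, forall j, (j0 <= j)%N ->
  (j.+1%:R^-1) ^+ (N + 2) <= P (tube (f x) j.+1%:R^-1)}.
Proof.
suff h (K : nat) : mu.-negligible [set x | enorm (f x) <= K%:R /\
    ~ exists j0, forall j, (j0 <= j)%N ->
      (j.+1%:R^-1) ^+ (N + 2) <= P (tube (f x) j.+1%:R^-1)].
  apply: negligibleS (negligible_bigcup h) => x /= nx.
  exists (Num.trunc (enorm (f x))).+1 => //; split=> //.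
  by apply: ltW; exact: truncnS_gt.
pose E (j : nat) := [set x | enorm (f x) <= K%:R /\
  P (tube (f x) j.+1%:R^-1) < (j.+1%:R^-1) ^+ (N + 2)].
pose c : R := 2 * K%:R * N.+1%:R + 1.
have c0 : 0 <= c by rewrite addr_ge0// !mulr_ge0.
have hE j : outer_le mu (E j) (c ^+ N / j.+1%:R ^+ 2).
  have e0 : 0 < j.+1%:R^-1 :> R by rewrite invr_gt0.
  have [s [sE _ sc ss]] := @separated_cover (E j) K%:R _ e0 (fun x h => h.1).
  exists (\big[setU/set0]_(p <- s) tube (f p) j.+1%:R^-1); split.
  - by apply: bigsetU_measurable => p _; exact: tube_measurable.
  - by move=> x /sc[p ps xp]; rewrite -bigcup_seq; exists p.
  apply: le_trans (pr_bigU_le mu s (fun p => tube_measurable (f p) _)) _.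
  apply: le_trans (_ : \sum_(p <- s) (j.+1%:R^-1) ^+ (N + 2) <= _).
    by rewrite !big_seq; apply: ler_sum => p /sE[_ /ltW].
  rewrite big_const_seq count_predT iter_addr_0 -[leLHS]mulr_natl.
  apply: le_trans (_ : (c / j.+1%:R^-1) ^+ N * (j.+1%:R^-1) ^+ (N + 2) <= _).
    rewrite ler_wpM2r ?exprn_ge0 ?(ltW e0)//.
    apply: le_trans (_ : ((grid_size N K%:R (j.+1%:R^-1 : R)).+1 ^ N)%N%:R <= _).
      by rewrite ler_nat.
    rewrite natrX lerXn2r ?nnegrE ?divr_ge0 ?(ltW e0)//.
    by apply: grid_size_bound => //; rewrite invf_le1// ler1n.
  rewrite exprMn exprD -!mulrA ler_wpM2l ?exprn_ge0// mulrA -exprMn invrK.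
  by rewrite divff ?expr1n ?mul1r -?exprVn ?lexx// pnatr_eq0.
have [U [mU EU Usmall]] := outer_borel_cantelli hE.
apply: outer_le_negligible => e /Usmall[q0 /(_ q0 (leqnn _)) hq].
exists (\bigcup_(k in [set k | (q0 <= k)%N]) U k); split => //.
  exact: bigcup_measurable.
move=> x [xK nx]; apply: contrapT => nU; apply: nx; exists q0 => j q0j.
rewrite leNgt; apply/negP => h; apply: nU; exists j => //; apply: EU.
by split.
Qed.

(** * Short returns *)

(** The index k stands for the return time k + 1. With the exponent 2D, a bound m^D <= r at this
    scale becomes m <= 1/(k+1)^2. *)
Definition return_scale (D k : nat) : R := (k.+1%:R ^+ (2 * D))^-1.

Lemma return_scale_gt0 D k : 0 < return_scale D k.
Proof. by rewrite invr_gt0 exprn_gt0. Qed.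

Lemma return_scale_le1 D k : return_scale D k <= 1.
Proof. by rewrite invf_le1 ?exprn_gt0// exprn_ege1// ler1n. Qed.

(** The measure condition will hold, at small scales, near a fibre whose tubes satisfy m^D <= r; it
    makes the product term in mixing summable over [k]. *)
Definition early_return (D K k : nat) : set X := [set x | [/\ enorm (f x) <= K%:R,
  P (tube (f x) (2 * return_scale D k)) <= 3 / k.+1%:R ^+ 2 &
  enorm (f (iter k.+1 T x) - f x) < return_scale D k]].

(** Cover by tubes of radius rho with separated centres: a returning point of the tube at p comes
    back to the doubled tube at p. Mixing bounds the measure of this event by the square of that of
    the doubled tube plus an error. Bounded overlap controls the squares, and the decay beats the
    polynomial number of tubes. *)
Lemma early_return_outer_le (D K : nat) :
  exists C, forall k, outer_le mu (early_return D K k) (C / k.+1%:R ^+ 2).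
Proof.
have [theta [theta_bound hdec]] := decay_tubes.
(* The exponent pays for the number of tubes, rho^-N, for the cutoff slope, rho^-1, and for the
   factor (k+1)^2 wanted in the conclusion. *)
have [C1 hC1] := theta_bound (2 * D * N.+1 + 2)%N.
pose c : R := 2 * K%:R * N.+1%:R + 1.
have c0 : 0 <= c by rewrite addr_ge0// !mulr_ge0.
(* By scaling, this bounds the number of rho-separated centres within 2 rho of a point. *)
pose B : nat := (grid_size N (2 : R) 1).+1 ^ N.
exists (3 * B%:R + c ^+ N * C1) => k.
set rho := return_scale D k; have rho0 : 0 < rho by exact: return_scale_gt0.
have [s [sE sp sc ss]] := @separated_cover (early_return D K k) K%:R rho rho0
  (fun x h => let: And3 h _ _ := h in h).
pose F p := tube (f p) rho `&` iter k.+1 T @^-1` tube (f p) (2 * rho).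
have mF p : measurable (F p).
  apply: measurableI; first exact: tube_measurable.
  by apply: preim_iter_measurable; exact: tube_measurable.
exists (\big[setU/set0]_(p <- s) F p); split.
- exact: bigsetU_measurable.
- move=> x Wx; have [p ps xp] := sc x Wx; rewrite -bigcup_seq; exists p => //.
  split=> //; rewrite /tube/eball/=; have [_ _ xr] := Wx.
  apply: le_lt_trans (enorm_tri (f x) _ _) _; move: xp xr; rewrite -/rho/=; lra.
apply: le_trans (pr_bigU_le mu s mF) _.
apply: le_trans (_ : \sum_(p <- s) (3 / k.+1%:R ^+ 2 * P (tube (f p) (2 * rho) `&` setT)
   + theta k.+1 / rho) <= _).
  rewrite !big_seq; apply: ler_sum => p /sE[_ hp _].
  have rr : rho < 2 * rho by lra.
  have [h _] := hdec (f p) rho (2 * rho) _ k.+1 rr (tube_measurable (f p) (2 * rho)) isT.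
  apply: le_trans h _; rewrite setIT (_ : 2 * rho - rho = rho); last by ring.
  by rewrite lerD2r ler_wpM2r// pr_ge0.
rewrite big_split/= -mulr_sumr [leRHS]mulrDl; apply: lerD.
  apply: le_trans (_ : 3 / k.+1%:R ^+ 2 * (B%:R * P setT) <= _); last first.
    by rewrite prT mulr1 mulrAC.
  rewrite ler_wpM2l ?divr_ge0//; apply: pr_overlap => //.
    by move=> p; exact: tube_measurable.
  move=> x; rewrite (_ : B = (grid_size N (2 * rho) rho).+1 ^ N)%N; last first.
    congr (_.+1 ^ _)%N; congr Num.trunc; field.
    by rewrite gt_eqF.
  rewrite -size_filter; apply: (@packing _ _ _ f (f x) (2 * rho) rho) => //.
    apply/allP => p; rewrite mem_filter => /andP[/asboolP xp _].
    by rewrite enorm_distC ltW.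
  exact: pairwise_filter.
rewrite big_const_seq count_predT iter_addr_0 -[leLHS]mulr_natl.
have rhoV : rho^-1 = k.+1%:R ^+ (2 * D) by rewrite /rho/return_scale invrK.
have cs : (size s)%:R <= (c / rho) ^+ N.
  apply: le_trans (_ : ((grid_size N K%:R rho).+1 ^ N)%N%:R <= _); first by rewrite ler_nat.
  rewrite natrX lerXn2r ?nnegrE ?divr_ge0 ?(ltW rho0)//.
  by apply: grid_size_bound => //; exact: return_scale_le1.
(* Testing mixing on the empty set shows that the rate is nonnegative. *)
have th0 : 0 <= theta k.+1.
  have [h1 h2] := hdec 0 0 1 set0 k.+1 ltr01 measurable0 isT.
  by move: h2; rewrite preimage_set0 setI0 pr0 mulr0 sub0r subr0 divr1 oppr_le0.
apply: le_trans (ler_wpM2r _ cs) _; first by rewrite divr_ge0// ltW.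
rewrite exprMn rhoV -exprM.
apply: le_trans (_ : c ^+ N * (theta k.+1 * k.+1%:R ^+ (2 * D * N.+1 + 2)) / k.+1%:R ^+ 2 <= _).
  rewrite le_eqVlt; apply/orP; left; apply/eqP.
  rewrite exprD mulnS exprD; field.
  by rewrite nat1r pnatr_eq0.
rewrite ler_wpM2r ?invr_ge0 ?exprn_ge0// ler_wpM2l ?exprn_ge0//.
exact: hC1.
Qed.

(** For one time the near returns decrease, as s tends to 0, to exact returns, which are null by
    aperiodicity; finitely many times follow by induction. *)
Lemma near_return_small (q : nat) (e : R) : almost_aperiodic mu T f -> 0 < e ->
  exists2 s, 0 < s &
    P (\big[setU/set0]_(0 <= k < q) [set x | enorm (f (iter k.+1 T x) - f x) < s]) <= e.
Proof.
move=> aper; elim: q e => [|q IH] e e0.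
  by exists 1 => //; rewrite big_geq// pr0 ltW.
have e20 : 0 < e / 2 by rewrite divr_gt0.
have [s1 s10 hs1] := IH _ e20.
pose V n := [set x | enorm (f (iter q.+1 T x) - f x) < n.+1%:R^-1].
have mV n : measurable (V n) by exact: near_return_measurable.
have [||n hn] := @pr_bigcap_small V (e / 2) mV _ _ e20.
- move=> m n mn x /= h; apply: lt_le_trans h _.
  by rewrite lef_pV2 ?posrE// ler_nat.
- have mI : measurable (\bigcap_n V n) by apply: bigcap_measurable => //; exists 0%N.
  have mA : measurable [set x | exists n : nat, (0 < n)%N /\ f (iter n T x) = f x].
    rewrite (_ : mkset _ = \bigcup_n \bigcap_m [set x | enorm (f (iter n.+1 T x) - f x) < m.+1%:R^-1]).
      apply: bigcup_measurable => n _; apply: bigcap_measurable; first by exists 0%N.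
      by move=> m _; exact: near_return_measurable.
    apply/seteqP; split=> x /=.
      move=> [[|n] [//= _ fx]]; exists n => // m _ /=; rewrite fx subrr.
      by rewrite -(scale0r 0) enormZ normr0 mul0r invr_gt0.
    move=> [n _ h]; exists n.+1; split=> //; apply/eqP; rewrite -subr_eq0.
    apply/eqP/enorm0_eq0/eqP; rewrite eq_le enorm_ge0 andbT.
    apply/ler_addgt0Pl => z z0; rewrite addr0.
    pose m := Num.trunc z^-1; apply: le_trans (ltW (h m I)) _.
    by rewrite -[leRHS]invrK lef_pV2 ?posrE ?invr_gt0// ltW// truncnS_gt.
  apply/eqP; rewrite eq_le pr_ge0 andbT.
  rewrite (_ : 0 = P [set x | exists n : nat, (0 < n)%N /\ f (iter n T x) = f x]); last first.
    by rewrite /pr aper.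
  apply: pr_le => // x h /=; exists q.+1; split=> //; apply/eqP; rewrite -subr_eq0.
  apply/eqP/enorm0_eq0/eqP; rewrite eq_le enorm_ge0 andbT.
  apply/ler_addgt0Pl => z z0; rewrite addr0.
  pose m := Num.trunc z^-1; apply: le_trans (ltW (h m I)) _.
  by rewrite -[leRHS]invrK lef_pV2 ?posrE ?invr_gt0// ltW// truncnS_gt.
exists (Num.min s1 n.+1%:R^-1); first by rewrite lt_min s10/= invr_gt0.
rewrite big_nat_recr//=; set s := Num.min _ _.
have mB t : measurable (\big[setU/set0]_(0 <= k < q) [set x | enorm (f (iter k.+1 T x) - f x) < t]).
  by apply: bigsetU_measurable => k _; exact: near_return_measurable.
apply: le_trans (prU_le mu (mB s) (near_return_measurable q.+1 s)) _.
rewrite [leRHS]splitr; apply: lerD.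
  apply: le_trans hs1; apply: pr_le => // x; rewrite -!bigcup_seq => -[k kq /= h].
  by exists k => //=; apply: lt_le_trans h _; rewrite ge_min lexx.
apply: le_trans hn; apply: pr_le => //; first exact: near_return_measurable.
by move=> x /= h; apply: lt_le_trans h _; rewrite ge_min lexx orbT.
Qed.

Definition survive (A : set X) (k : nat) : set X :=
  [set x | forall j, (0 < j <= k)%N -> ~ A (iter j T x)].

Lemma survive_measurable A k : measurable A -> measurable (survive A k).
Proof.
move=> mA; rewrite (_ : survive A k =
    \bigcap_(j in [set j | (0 < j <= k)%N]) ~` (iter j T @^-1` A)).
  have [->|/set0P ne] := eqVneq [set j | (0 < j <= k)%N] set0.
    by rewrite bigcap_set0.
  apply: bigcap_measurable => // j _; apply: measurableC.
  exact: preim_iter_measurable.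
by apply/seteqP; split=> x h j /= jk; exact: h.
Qed.

(* The fast returns to the tube of radius r around a typical fibre lie in a fixed
   set H q of small measure, whose density in that tube is controlled by the
   maximal inequality. *)
Lemma short_returns (D K : nat) : (0 < D)%N -> almost_aperiodic mu T f ->
  {ae mu, forall x0, enorm (f x0) + 1 <= K%:R ->
    (exists2 r1, 0 < r1 & forall r, 0 < r < r1 -> P (tube (f x0) r) ^+ D <= r) ->
    forall lam, 0 < lam -> exists2 r2, 0 < r2 & forall r n, 0 < r < r2 ->
      2 * r * n%:R ^+ (2 * D) <= 1 ->
      P (tube (f x0) r `&` ~` survive (tube (f x0) r) n) <=
        lam * P (tube (f x0) r)}.
Proof.
move=> D0 aper.
have [C hC] := early_return_outer_le D K.
have [U [mU EU Usmall]] := outer_borel_cantelli hC.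
have /choice[s hs] (q : nat) : exists s, 0 < s /\
    P (\big[setU/set0]_(0 <= k < q) [set x | enorm (f (iter k.+1 T x) - f x) < s]) <= q.+1%:R^-1.
  have [|s s0 hs] := near_return_small q (e := q.+1%:R^-1) aper; first by rewrite invr_gt0.
  by exists s.
pose M q := \big[setU/set0]_(0 <= k < q) [set x | enorm (f (iter k.+1 T x) - f x) < s q].
have mM q : measurable (M q).
  by apply: bigsetU_measurable => k _; exact: near_return_measurable.
(* Early returns at times after q are covered by the tail, near returns up to time q by [M q]. *)
pose H q := \bigcup_(k in [set k | (q <= k)%N]) U k `|` M q.
have mUq q : measurable (\bigcup_(k in [set k | (q <= k)%N]) U k) by exact: bigcup_measurable.
have mH q : measurable (H q) by apply: measurableU.
have Hsmall e : 0 < e -> exists q0, forall q, (q0 <= q)%N -> P (H q) <= e.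
  move=> e0; have e20 : 0 < e / 2 by rewrite divr_gt0.
  have [q1 hq1] := Usmall _ e20.
  exists (maxn q1 (Num.trunc (e / 2)^-1)) => q; rewrite geq_max => /andP[qq1 qt].
  apply: le_trans (prU_le mu (mUq q) (mM q)) _.
  rewrite [leRHS]splitr; apply: lerD; first exact: hq1.
  apply: le_trans (hs q).2 _; rewrite -[leRHS]invrK lef_pV2 ?posrE ?invr_gt0//.
  by apply: ltW; apply: lt_le_trans (truncnS_gt _) _; rewrite ler_nat.
(* Each such set is null, since the maximal inequality bounds it by a multiple of [P (H q)] for
   every q >= k0. Outside it, a single [H q] has small density at all radii. *)
pose Z l k0 := [set x | forall q, (k0 <= q)%N -> exists2 r, 0 < r &
   l.+1%:R^-1 * P (tube (f x) r) < P (tube (f x) r `&` H q)].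
have negZ : mu.-negligible (\bigcup_l \bigcup_k0 Z l k0).
  apply: negligible_bigcup => l; apply: negligible_bigcup => k0.
  apply: outer_le_negligible => e e0.
  pose c : R := overlap_bound%:R / l.+1%:R^-1 + 1.
  have c0 : 0 < c by rewrite ltr_wpDl// divr_ge0.
  have [q0 hq0] := Hsmall (e / c) (divr_gt0 e0 c0).
  have l0 : 0 < l.+1%:R^-1 :> R by rewrite invr_gt0.
  apply: outer_le_sub (maximal_inequality l0 (mH (maxn k0 q0))).
    by move=> x; apply; exact: leq_maxl.
  apply: le_trans (_ : c * (e / c) <= _); last by rewrite mulrC divfK// gt_eqF.
  apply: ler_pM; rewrite ?divr_ge0 ?pr_ge0//; first by rewrite lerDl.
  by apply: hq0; exact: leq_maxr.
apply: negligibleS negZ => x0 /= nx0; apply: contrapT => nZ; apply: nx0.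
move=> x0K [r1 r10 hr1] lam lam0.
pose l := Num.trunc lam^-1.
have ll : l.+1%:R^-1 <= lam.
  by rewrite -[leRHS]invrK lef_pV2 ?posrE ?invr_gt0// ltW// truncnS_gt.
(* From this index on, 3 times the return scale is below [r1], where the dimension bound is
   available. *)
pose k0 := Num.trunc (3 / r1).
have hk0 k : (k0 <= k)%N -> 3 * return_scale D k < r1.
  move=> kk; have k1 : 3 / r1 < k.+1%:R.
    by apply: lt_le_trans (truncnS_gt _) _; rewrite ler_nat.
  apply: le_lt_trans (_ : 3 / k.+1%:R < _); last by rewrite ltr_pdivrMr// mulrC -ltr_pdivrMr.
  rewrite ler_pM2l// lef_pV2 ?posrE ?exprn_gt0//.
  by rewrite -[leLHS]expr1 ler_weXn2l ?ler1n//; lia.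
have [q [kq hq]] : exists q, (k0 <= q)%N /\ forall r, 0 < r ->
    P (tube (f x0) r `&` H q) <= l.+1%:R^-1 * P (tube (f x0) r).
  apply: contrapT => none; apply: nZ; exists l => //; exists k0 => // q kq.
  apply: contrapT => none'; apply: none; exists q; split=> // r r0.
  by rewrite leNgt; apply/negP => h; apply: none'; exists r.
have sq0 := (hs q).1.
(* The first bound keeps f x in the region given by [K], the second puts returns up to time q in
   [M q]. *)
exists (Num.min 1 (s q / 2)); first by rewrite lt_min ltr01 divr_gt0.
move=> r n /andP[r0]; rewrite lt_min => /andP[r1' rs] rn.
apply: le_trans (_ : P (tube (f x0) r `&` H q) <= _); last first.
  by rewrite (le_trans (hq r r0))// ler_wpM2r ?pr_ge0.
apply: pr_le.
- apply: measurableI; first exact: tube_measurable.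
  by apply/measurableC/survive_measurable; exact: tube_measurable.
- by apply: measurableI; first exact: tube_measurable.
move=> x [xr nS]; split=> //.
have [k kn kr] : exists2 k, (k < n)%N & tube (f x0) r (iter k.+1 T x).
  apply: contrapT => none; apply: nS => -[//|k] /= kn kr.
  by apply: none; exists k.
have near : enorm (f (iter k.+1 T x) - f x) < 2 * r.
  apply: le_lt_trans (enorm_tri (f x0) _ _) _; move: xr kr.
  rewrite /tube/eball/= (enorm_distC (f x0)); lra.
have [kq'|qk] := ltnP k q.
  right; rewrite /M -bigcup_seq; exists k; first by rewrite /= mem_index_iota.
  by apply: lt_trans near _; lra.
left; exists k => //; apply: EU.
have rk : 2 * r <= return_scale D k.
  rewrite /return_scale -[leRHS]mul1r ler_pdivlMr ?exprn_gt0//.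
  apply: le_trans rn; rewrite ler_wpM2l ?mulr_ge0 ?(ltW r0)//.
  by rewrite lerXn2r ?nnegrE// ler_nat.
split.
- have := enorm_tri (f x0) (f x) 0; rewrite !subr0; move: xr; rewrite /tube/eball/=; lra.
(* As r is at most the scale, the ball of twice the scale at f x lies in the ball of three times the
   scale at f x0. The D-th power of its measure is thus at most 3 times the scale, hence at most the
   D-th power of 3/(k+1)^2. *)
- apply: le_trans (_ : P (tube (f x0) (3 * return_scale D k)) <= _).
    apply: pr_le; [exact: tube_measurable|exact: tube_measurable|].
    move=> z; rewrite /tube/eball/= => hz.
    apply: le_lt_trans (enorm_tri (f x) _ _) _; move: xr hz; rewrite /tube/eball/=; lra.
  rewrite -(@ler_pXn2r _ D)// ?nnegrE ?pr_ge0 ?divr_ge0//.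
  have rk0 := return_scale_gt0 D k.
  apply: le_trans (hr1 _ _) _; first by rewrite mulr_gt0// hk0// (leq_trans kq).
  rewrite expr_div_n -exprM ler_wpM2r ?invr_ge0 ?exprn_ge0//.
  by rewrite -[leLHS]expr1 ler_weXn2l//; lra.
- exact: lt_le_trans near rk.
Qed.

(** * Hitting times *)

Section HittingTime.
Variable A : set X.
Hypothesis mA : measurable A.
Local Notation S := (survive A).
Local Notation m := (P A).
Let mS k : measurable (S k) := survive_measurable k mA.

(** Avoiding A at the times 1, ..., k + 1 means that T x lies off A and itself avoids A up to time
    k. *)
Lemma survive_recursion k : P (S k.+1) = P (S k) - P (A `&` S k).
Proof.
have -> : S k.+1 = iter 1 T @^-1` (S k `\` A).
  apply/seteqP; split=> [x h|x [h nA]].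
    split=> [j /andP[j0 jk]|]; last exact: (h 1%N).
    by have := h j.+1; rewrite iterSr; apply; rewrite ltnS.
  move=> [//|[_ //|j]] jk; rewrite iterSr; apply: h.
  by move: jk; rewrite !ltnS.
rewrite pr_iter; last exact: measurableD.
by rewrite (prDI mu (mS k) mA) setIC addrK.
Qed.

(** The error contracts by 1 - m at each step and gains at most e m, so the bound [e] reproduces
    itself. *)
Lemma survive_geometric (e : R) : 0 <= e ->
  (forall k, `|P (A `&` S k) - m * P (S k)| <= e * m) ->
  forall k, `|P (S k) - (1 - m) ^+ k| <= e.
Proof.
move=> e0 h; have m1 := pr_le1 mu mA; have m0 := pr_ge0 mu A.
elim=> [|k IH].
  rewrite (_ : S 0 = setT); last by apply/seteqP; split=> // x _ [].
  by rewrite prT expr0 subrr normr0.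
rewrite survive_recursion exprS.
rewrite (_ : _ - _ = (1 - m) * (P (S k) - (1 - m) ^+ k) -
    (P (A `&` S k) - m * P (S k))); last by ring.
apply: le_trans (ler_normB _ _) _; rewrite normrM (ger0_norm (_ : 0 <= 1 - m)) ?subr_ge0//.
apply: le_trans (lerD (ler_wpM2l _ IH) (h k)) _; first by rewrite subr_ge0.
by rewrite -(mulrC m) -mulrDl subrK mul1r.
Qed.

Lemma surviveC_le n : P (~` S n) <= n%:R * m.
Proof.
have -> : ~` S n = \big[setU/set0]_(1 <= j < n.+1) (iter j T @^-1` A).
  apply/seteqP; split=> x.
    move=> h; apply: contrapT => nx; apply: h => j jn Aj; apply: nx.
    by rewrite -bigcup_seq; exists j => //=; rewrite mem_index_iota.
  rewrite -bigcup_seq => -[j /=]; rewrite mem_index_iota ltnS => jn Aj h.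
  exact: h Aj.
apply: le_trans (pr_bigU_le mu _ _) _; first by move=> j; exact: preim_iter_measurable.
under eq_bigr do rewrite pr_iter//.
by rewrite big_const_nat subn1 iter_addr_0 mulr_natl.
Qed.

Lemma survive_split n k : (n <= k)%N ->
  S k = S n `&` iter n T @^-1` S (k - n).
Proof.
move=> nk; apply/seteqP; split=> x.
  move=> h; split=> [j /andP[j0 jn]|j /andP[j0 jn]]; first by apply: h; lia.
  by rewrite -iterD; apply: h; lia.
move=> [h1 h2] j /andP[j0 jk]; have [jn|nj] := leqP j n; first by apply: h1; lia.
by rewrite -(subnK (ltnW nj)) iterD; apply: h2; lia.
Qed.

(* After time n the orbit has forgotten A by mixing; before time n the orbit
   rarely visits A, whether or not it starts there. *)
Lemma survive_decorrelation (n : nat) (lam beta : R) : 0 <= lam -> 0 <= beta ->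
  (forall V, measurable V ->
     `|P (A `&` iter n T @^-1` V) - m * P V| <= beta) ->
  P (A `&` ~` S n) <= lam * m ->
  forall k, `|P (A `&` S k) - m * P (S k)| <= lam * m + n%:R * m * m + beta.
Proof.
move=> lam0 beta0 hV hn k; have m1 := pr_le1 mu mA; have m0 := pr_ge0 mu A.
have hC := surviveC_le n.
have nm0 : 0 <= n%:R * m by rewrite mulr_ge0.
have diff B : measurable B -> 0 <= P B - P (B `&` S n) /\
    P B - P (B `&` S n) = P (B `&` ~` S n).
  by move=> mB; rewrite (prDI mu mB (mS n)) addrK -setDE pr_ge0.
have mSC := measurableC (mS n).
(* Imposing [S n] removes at most lam m from the part of V in A and at most n m from V. *)
have cmp (V : set X) : measurable V ->
   `|P (A `&` (V `&` S n)) - m * P (V `&` S n) - (P (A `&` V) - m * P V)| <=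
     lam * m + n%:R * m * m.
  move=> mV; have mAV := measurableI _ _ mA mV.
  have [d1 d1'] := diff _ mAV; have [d2 d2'] := diff _ mV.
  have e1 : P (A `&` V `&` ~` S n) <= lam * m.
    apply: le_trans hn; apply: pr_le; [exact: measurableI|exact: measurableI|].
    by move=> x [[]].
  have e2 : P (V `&` ~` S n) <= n%:R * m.
    by apply: le_trans hC; apply: pr_le => //; exact: measurableI.
  rewrite setIA.
  have := ler_wpM2r m0 e2; have := mulr_ge0 d2 m0; rewrite -d2' => e3 e4.
  have lm0 := mulr_ge0 lam0 m0; have nmm0 := mulr_ge0 nm0 m0.
  rewrite ler_norml; lra.
have [nk|kn] := leqP n k.
  rewrite (survive_split nk) setIC.
  set V := iter n T @^-1` _.
  have mV : measurable V by exact: preim_iter_measurable.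
  have := cmp V mV; have := hV _ (mS (k - n)); rewrite -/V -(pr_iter n (mS (k - n))) -/V.
  rewrite [S n `&` V]setIC (setIC _ A); move=> h1 h2.
  move: h1 h2; rewrite !ler_norml; lra.
(* For k < n the set [S k] contains [S n], so both [S k] and its part in A are almost full. *)
have SS : S n `<=` S k by move=> x h j /andP[j0 jk]; apply: h; lia.
have mk := mS k.
have e1 : P A - P (A `&` S k) <= lam * m.
  rewrite {1}(prDI mu mA mk) addrK; apply: le_trans hn.
  apply: pr_le; [exact: measurableD|exact: measurableI|].
  by move=> x [Ax nx]; split=> // /SS.
have e1' : 0 <= P A - P (A `&` S k) by rewrite {1}(prDI mu mA mk) addrK pr_ge0.
have e2 : 1 - P (S k) <= n%:R * m.
  rewrite -prC//; apply: le_trans hC; apply: pr_le => //; first exact: measurableC.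
  by move=> x h /SS.
have e2' : 0 <= 1 - P (S k) by rewrite subr_ge0 pr_le1.
have := ler_wpM2r m0 e2; have := mulr_ge0 e2' m0 => e3 e4.
have lm0 := mulr_ge0 lam0 m0; have nmm0 := mulr_ge0 nm0 m0.
rewrite ler_norml; lra.
Qed.

End HittingTime.

(** Hitting times are integers or infinite, so exceeding t means being at least 1 +
    [Num.trunc t]. *)
Lemma survive_hit_time (t r : R) (x0 : X) : 0 <= t ->
  [set x | (hit_time T f r x x0 > t%:E)%E] = survive (tube (f x0) r) (Num.trunc t).
Proof.
move=> t0; have /andP[t1 t2] := truncn_itv t0.
apply/seteqP; split=> x /=.
  move=> h j /andP[j0 jt] hit.
  have : (hit_time T f r x x0 <= j%:R%:E)%E by apply: ereal_inf_lbound; exists j.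
  by move=> /(lt_le_trans h); rewrite lte_fin ltNge (le_trans _ t1)// ler_nat.
move=> h; apply: (@lt_le_trans _ _ (Num.trunc t).+1%:R%:E); first by rewrite lte_fin.
apply/ereal_infP => _ [j [j0 hit] <-]; rewrite lee_fin ler_nat ltnNge.
by apply/negP => jt; apply: (h j) => //; rewrite j0.
Qed.

(** * Limits as the radius tends to 0 *)

Lemma near_right0P (Q : R -> Prop) : (\forall r \near 0^'+, Q r) <->
  exists2 e, 0 < e & forall r, 0 < r < e -> Q r.
Proof.
split=> [[e /= e0 he]|[e e0 he]].
  exists e => // r /andP[r0 re]; apply: he => //.
  by rewrite /ball_/= sub0r normrN ger0_norm// ltW.
by exists e => // r /=; rewrite sub0r normrN => re r0; apply: he; rewrite r0 (le_lt_trans (ler_norm _)).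
Qed.

(** A bound log m / log r >= dl > 0 means m <= r^dl; an integer D above 1/dl avoids real powers. *)
Lemma lower_dim_gt0 (y : 'rV[R]_N) : (0 < lower_dim mu f y)%E ->
  exists2 D : nat, (0 < D)%N & \forall r \near 0^'+, P (tube y r) ^+ D <= r.
Proof.
rewrite /lower_dim limf_einfE => /ereal_sup_gt[_ [B /= hB <-] h].
have [dl dl0 hd] : exists2 dl : R, 0 < dl & forall r, B r -> P (tube y r) != 0 ->
    dl <= ln (P (tube y r)) / ln r.
  set I := ereal_inf _ in h.
  have hI r : B r -> P (tube y r) != 0 -> (I <= (ln (P (tube y r)) / ln r)%:E)%E.
    move=> Br m0; apply: ereal_inf_lbound; exists r => //.
    by rewrite /push -/(P _) (negbTE m0).
  (* If the infimum is infinite, all tubes with radius in [B] are null and any positive dl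
     serves. *)
  move: I h hI => [dl| |]//.
    by rewrite lte_fin => dl0 hI; exists dl => // r Br m0; rewrite -lee_fin; exact: hI.
  by move=> _ hI; exists 1 => // r Br m0; have := hI r Br m0; rewrite leye_eq.
pose D := (Num.trunc dl^-1).+1; exists D => //.
have Ddl : 1 <= D%:R * dl by rewrite -ler_pdivrMr// mul1r ltW// truncnS_gt.
near=> r.
have r0 : 0 < r by near: r; exact: nbhs_right_gt.
have r1 : r < 1 by near: r; exact: nbhs_right_lt.
have Br : B r by near: r.
have [->|m0] := eqVneq (P (tube y r)) 0; first by rewrite expr0n/= ltW.
have mp : 0 < P (tube y r) by rewrite lt_def m0 pr_ge0.
rewrite -ler_ln ?posrE ?exprn_gt0// lnXn// -mulr_natl.
have lr : ln r < 0 by rewrite ln_lt0// r0.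
have := hd r Br m0; rewrite ler_ndivlMr// => h1.
have D0 : 0 <= D%:R :> R by [].
have := ler_wpM2l D0 h1; nra.
Unshelve. all: by end_near. Qed.

Lemma preim_eborel_measurable (E : set 'rV[R]_N) : eborel E -> measurable (f @^-1` E).
Proof.
move=> hE; apply: (hE [set B | measurable (f @^-1` B)]); split; first split => /=.
- by rewrite preimage_set0.
- by move=> B mB; rewrite setTD preimage_setC; exact: measurableC.
- by move=> F mF; rewrite preimage_bigcup; apply: bigcup_measurable => k _; exact: mF.
move=> B oB; apply: dopen_measurable => x /= Bx.
have [L L0 hL] := f_lipschitz_gt0; have [e e0 he] := oB _ Bx.
exists (e / L); first by rewrite divr_gt0.
move=> z; rewrite ltr_pdivlMr// => xz; apply: he; rewrite /eball/=.
by rewrite enorm_distC (le_lt_trans (hL _ _))// mulrC.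
Qed.

(** Round r down to 1/(j+1), with j the integer part of 1/r. As r < 1/2, r^2 <= 1/(j+1), which is
    why the exponent doubles. *)
Lemma ball_measure_power_bound : {ae mu, forall x,
  \forall r \near 0^'+, r ^+ (2 * (N + 2)) <= P (tube (f x) r)}.
Proof.
apply: filterS ball_measure_lower_bound => x [j0 hj0].
near=> r.
have r0 : 0 < r by near: r; exact: nbhs_right_gt.
have r2 : r < 2^-1 by near: r; apply: nbhs_right_lt; rewrite invr_gt0.
have rj : r < j0.+1%:R^-1 by near: r; apply: nbhs_right_lt; rewrite invr_gt0.
pose j := Num.trunc r^-1.
have /andP[j1 j2] : j%:R <= r^-1 < j.+1%:R by apply: truncn_itv; rewrite invr_ge0 ltW.
have jj : (j0 <= j)%N.
  rewrite -ltnS -(ltr_nat R); apply: lt_trans j2.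
  apply: lt_trans (_ : j0.+1%:R < _); first by rewrite ltr_nat.
  by rewrite -[ltLHS]invrK ltf_pV2 ?posrE ?invr_gt0.
apply: le_trans (le_trans (hj0 j jj) _).
  rewrite exprM lerXn2r ?nnegrE ?exprn_ge0 ?invr_ge0 ?(ltW r0)//.
  rewrite -[leRHS]mul1r ler_pdivlMr// -natr1 mulrDr mulr1.
  have : r ^+ 2 * j%:R <= r.
    by rewrite -[leRHS](_ : r ^+ 2 * r^-1 = _) ?ler_wpM2l ?sqr_ge0//; field; rewrite gt_eqF.
  by nra.
apply: pr_le; [exact: tube_measurable|exact: tube_measurable|].
by apply: tube_le; rewrite -[leRHS]invrK lef_pV2 ?posrE ?invr_gt0// ltW.
Unshelve. all: by end_near. Qed.

(** From exp(-m/(1-m)) <= 1 - m <= exp(-m), where the exponent k satisfies t - m < k m <= t. *)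
Lemma geometric_bounds (t m : R) : 0 <= t -> 0 < m -> m < 1 ->
  expR (- t / (1 - m)) <= (1 - m) ^+ Num.trunc (t / m) <= expR (- t + m).
Proof.
move=> t0 m0 m1; have m1' : 0 < 1 - m by rewrite subr_gt0.
have /andP[k1 k2] : (Num.trunc (t / m))%:R <= t / m < (Num.trunc (t / m)).+1%:R.
  by apply: truncn_itv; rewrite divr_ge0// ltW.
move: (Num.trunc _) k1 k2 => k; rewrite ler_pdivlMr// ltr_pdivrMr// -natr1 => k1 k2.
apply/andP; split.
  apply: le_trans (_ : expR (- m / (1 - m)) ^+ k <= _).
    rewrite -expRM_natl ler_expR mulrA ler_pM2r ?invr_gt0//; lra.
  rewrite lerXn2r ?nnegrE ?expR_ge0 ?(ltW m1')//.
  rewrite mulNr expRN -[leRHS]invrK lef_pV2 ?posrE ?expR_gt0 ?invr_gt0//.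
  apply: le_trans (expR_ge1Dx _); rewrite le_eqVlt; apply/orP; left; apply/eqP.
  by field; rewrite gt_eqF.
apply: le_trans (_ : expR (- m) ^+ k <= _).
  rewrite lerXn2r ?nnegrE ?expR_ge0 ?(ltW m1')//.
  exact: expR_ge1Dx.
rewrite -expRM_natl ler_expR; lra.
Qed.

Lemma geometric_limit (t : R) (m : R -> R) : 0 <= t ->
  (forall e, 0 < e -> \forall r \near 0^'+, 0 < m r <= e) ->
  (fun r => (1 - m r) ^+ Num.trunc (t / m r)) @ 0^'+ --> expR (- t).
Proof.
move=> t0 hm.
have m_cvg : m @ 0^'+ --> (0 : R).
  apply/cvgrPdist_le => e e0; apply: filterS (hm e e0) => r /andP[mr me].
  by rewrite sub0r normrN ger0_norm// ltW.
have cexp := @continuous_expR R.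
apply: (@squeeze_cvgr _ _ _ _ (fun r => expR (- t / (1 - m r))) (fun r => expR (- t + m r))).
- apply: filterS (hm (2^-1) _); last by rewrite invr_gt0.
  move=> r /andP[mr me]; apply: geometric_bounds => //; lra.
- apply: (@cvg_comp _ _ _ (fun r => - t / (1 - m r)) expR _ (nbhs (- t))); last exact: cexp.
  suff : (fun r => - t / (1 - m r)) @ 0^'+ --> - t / (1 - 0) by rewrite subr0 divr1.
  apply: cvgM; first exact: cvg_cst.
  apply: cvgV; first by rewrite subr0 oner_neq0.
  by apply: cvgB => //; exact: cvg_cst.
- apply: (@cvg_comp _ _ _ (fun r => - t + m r) expR _ (nbhs (- t))); last exact: cexp.
  suff : (fun r => - t + m r) @ 0^'+ --> - t + 0 by rewrite addr0.
  by apply: cvgD => //; exact: cvg_cst.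
Qed.

(** Take the largest n with the first inequality. It fails for n + 1, which is at most 2n; hence the
    factor 2^(2D). *)
Lemma exists_time_scale (D : nat) (r : R) : (0 < D)%N -> 0 < r -> 2 * r <= 1 ->
  exists n, [/\ (0 < n)%N, 2 * r * n%:R ^+ (2 * D) <= 1 &
    (n%:R ^+ (2 * D))^-1 <= 2 ^+ (2 * D) * (2 * r)].
Proof.
move=> D0 r0 r1; pose Q n := (0 < n)%N && (2 * r * n%:R ^+ (2 * D) <= 1).
have exQ : exists n, Q n by exists 1%N; rewrite /Q/= expr1n mulr1.
have ubQ n : Q n -> (n <= Num.trunc (2 * r)^-1)%N.
  move=> /andP[n0 hn]; rewrite truncn_ge_nat ?invr_ge0 ?mulr_ge0 ?(ltW r0)//.
  rewrite -[leRHS]mul1r ler_pdivlMr ?mulr_gt0// mulrC.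
  apply: le_trans hn; rewrite ler_pM2l ?mulr_gt0// -[leLHS]expr1 ler_weXn2l ?ler1n//; lia.
case: (ex_maxnP exQ ubQ) => n /andP[n0 hn] nmax; exists n; split=> //.
have : ~~ Q n.+1 by apply/negP => /nmax; rewrite ltnn.
rewrite /Q/= -ltNge => h.
have np : 0 < n%:R ^+ (2 * D) :> R by rewrite exprn_gt0// ltr0n.
rewrite -[leLHS]mul1r ler_pdivrMr//; apply: le_trans (ltW h) _.
have -> : 2 ^+ (2 * D) * (2 * r) * n%:R ^+ (2 * D) = 2 * r * (2 * n%:R) ^+ (2 * D).
  by rewrite exprMn; ring.
rewrite ler_wpM2l ?mulr_ge0 ?(ltW r0)// lerXn2r ?nnegrE ?mulr_ge0//.
by rewrite -natrM ler_nat; lia.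
Qed.

Lemma tube_decorrelation (x0 : X) (D E : nat) (a b : R) :
  (0 < D)%N -> 0 < a -> 0 <= b ->
  (\forall r \near 0^'+, P (tube (f x0) r) ^+ D <= r) ->
  (\forall r \near 0^'+, r ^+ E <= P (tube (f x0) r)) ->
  (\forall r \near 0^'+, forall rho, 0 < rho < r ->
     P (tube (f x0) r `\` tube (f x0) (r - rho)) <= r `^ (- b) * rho `^ a) ->
  (forall lam, 0 < lam -> \forall r \near 0^'+, forall n, 2 * r * n%:R ^+ (2 * D) <= 1 ->
     P (tube (f x0) r `&` ~` survive (tube (f x0) r) n) <= lam * P (tube (f x0) r)) ->
  forall e, 0 < e -> \forall r \near 0^'+,
    0 < P (tube (f x0) r) <= e /\
    forall k, `|P (tube (f x0) r `&` survive (tube (f x0) r) k) -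
       P (tube (f x0) r) * P (survive (tube (f x0) r) k)| <= e * P (tube (f x0) r).
Proof.
move=> D0 a0 b0 m_up m_low annulus short e e0.
have [theta [theta_bound hdec]] := decay_tubes.
(* With this exponent the annulus of width r^q has measure at most r^(E+1), hence at most r m; the
   added constant gives r^q < r. *)
pose q := (2 + Num.trunc ((b + E.+1%:R) / a)).+1.
have qa : E.+1%:R <= q%:R * a - b.
  rewrite lerBrDl -ler_pdivrMr//; apply: ltW.
  apply: lt_le_trans (truncnS_gt _) _; by rewrite ler_nat /q ltnS leq_addl.
(* Since n^-(2D) is O(r), decay to this power gives theta n = O(r^(q+E+1)), so the cutoff error
   theta n / r^q is O(r m). *)
pose PP := (q + E.+1)%N.
have [C hC] := theta_bound (2 * D * PP)%N.
have th0 n : (0 < n)%N -> 0 <= theta n.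
  move=> n0; have [_ h2] := hdec 0 0 1 set0 n ltr01 measurable0 n0.
  by move: h2; rewrite preimage_set0 setI0 pr0 mulr0 sub0r subr0 divr1 oppr_le0.
have C0 : 0 <= C.
  by apply: le_trans (hC 1%N isT); rewrite expr1n mulr1 th0.
pose C' : R := C * (2 ^+ (2 * D) * 2) ^+ PP.
have C'0 : 0 <= C' by rewrite mulr_ge0// exprn_ge0// mulr_ge0// exprn_ge0.
have e40 : 0 < e / 4 by rewrite divr_gt0.
near=> r.
have r0 : 0 < r by near: r; exact: nbhs_right_gt.
have r1 : r < 2^-1 by near: r; apply: nbhs_right_lt; rewrite invr_gt0.
have re : r < e ^+ D by near: r; apply: nbhs_right_lt; rewrite exprn_gt0.
have re4 : r < (e / 4) ^+ (2 * D) by near: r; apply: nbhs_right_lt; rewrite exprn_gt0.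
have rC : r < e / 2 / (1 + C').
  by near: r; apply: nbhs_right_lt; rewrite !divr_gt0// ltr_pwDl.
set A := tube (f x0) r; set m := P A.
have mA : measurable A by exact: tube_measurable.
have hup : m ^+ D <= r by rewrite /m/A; near: r.
have hlow : r ^+ E <= m by rewrite /m/A; near: r.
have hann : forall rho, 0 < rho < r ->
     P (tube (f x0) r `\` tube (f x0) (r - rho)) <= r `^ (- b) * rho `^ a by near: r.
have hshort : forall n, 2 * r * n%:R ^+ (2 * D) <= 1 ->
     P (A `&` ~` survive A n) <= e / 4 * m by rewrite /m/A; near: r; exact: short.
have mp : 0 < m by apply: lt_le_trans hlow; rewrite exprn_gt0.
have m1 : m <= 1 by exact: pr_le1.
split.
  have := le_trans hup (ltW re).
  by rewrite mp ler_pXn2r// nnegrE ltW.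
have [n [n0 n1 n2]] : exists n, [/\ (0 < n)%N, 2 * r * n%:R ^+ (2 * D) <= 1 &
    (n%:R ^+ (2 * D))^-1 <= 2 ^+ (2 * D) * (2 * r)].
  by apply: exists_time_scale => //; lra.
have rE : r ^+ E.+1 <= r * m by rewrite exprS ler_pM2l.
pose rho := r ^+ q.
have rho0 : 0 < rho by rewrite exprn_gt0.
have rhor : rho < r.
  rewrite /rho /q -[ltRHS]expr1 ltr_iXn2l//; lra.
pose B := tube (f x0) (r - rho).
have mB : measurable B by exact: tube_measurable.
have BA : B `<=` A by apply: tube_le; rewrite gerBl ltW.
have ringAB : P A - P B <= r * m.
  have -> : P A - P B = P (A `\` B).
    by rewrite (prDI mu mA mB) (setIidr BA) addrK.
  apply: le_trans (hann rho _) _; first by rewrite rho0.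
  apply: le_trans rE; rewrite /rho -!powR_mulrn ?(ltW r0)// -powRrM -powRD; last first.
    by rewrite (gt_eqF r0) implybT.
  apply: ger_powR; first by rewrite r0/=; lra.
  by rewrite addrC.
have thrho : theta n / rho <= C' * (r * m).
  apply: le_trans (_ : C' * r ^+ E.+1 <= _); last by rewrite ler_wpM2l.
  rewrite ler_pdivrMr// -mulrA -exprD addnC -/PP.
  have nD : 0 < n%:R ^+ (2 * D) :> R by rewrite exprn_gt0// ltr0n.
  apply: le_trans (_ : C * ((n%:R ^+ (2 * D))^-1) ^+ PP <= _).
    by rewrite exprVn -exprM ler_pdivlMr ?exprn_gt0 ?ltr0n// hC.
  rewrite /C' -mulrA -exprMn ler_wpM2l// lerXn2r ?nnegrE ?invr_ge0 ?(ltW nD)//.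
    by rewrite !mulr_ge0 ?exprn_ge0 ?(ltW r0).
  by rewrite -mulrA.
have thrho0 : 0 <= theta n / rho by rewrite divr_ge0 ?th0// ltW.
(* In the power 2D: n^(2D) m^(2D) <= n^(2D) r^2 <= r / 2, by the choice of n. *)
have nm : n%:R * m <= e / 4.
  have D20 : (0 < 2 * D)%N by rewrite muln_gt0.
  rewrite -(@ler_pXn2r _ (2 * D))// ?nnegrE ?mulr_ge0 ?(ltW mp) ?(ltW e0)//.
  apply: le_trans (ltW re4); rewrite exprMn.
  have mD : m ^+ (2 * D) <= r ^+ 2.
    by rewrite mulnC exprM lerXn2r ?nnegrE ?exprn_ge0 ?(ltW mp) ?(ltW r0).
  have nD0 : 0 <= n%:R ^+ (2 * D) :> R by rewrite exprn_ge0.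
  apply: le_trans (ler_wpM2l nD0 mD) _.
  have := ler_wpM2l (ltW r0) n1; rewrite expr2; lra.
have rm0 : 0 <= r * m by apply: mulr_ge0; exact: ltW.
have ringAB0 : 0 <= P A - P B by rewrite subr_ge0 pr_le.
move=> k.
have h : `|P (A `&` survive A k) - m * P (survive A k)| <=
    e / 4 * m + n%:R * m * m + (r * m + C' * (r * m)).
  apply: survive_decorrelation => //.
  - exact: ltW.
  - exact: addr_ge0 rm0 (mulr_ge0 C'0 rm0).
  (* Mixing compares the inner tube [B] with [A]; the annulus between them, of measure at most r m,
     closes the gap. *)
  - move=> V mV; have mTV : measurable (iter n T @^-1` V) by exact: preim_iter_measurable.
    have rr : r - rho < r by rewrite gtrBl.
    have [] := hdec (f x0) (r - rho) r V n rr mV n0.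
    rewrite (_ : r - (r - rho) = rho); last by ring.
    rewrite -/A -/B -/m => h1 h2.
    have h3 : P (A `&` iter n T @^-1` V) <= P (B `&` iter n T @^-1` V) + (P A - P B).
      have -> : P A - P B = P (A `\` B) by rewrite (prDI mu mA mB) (setIidr BA) addrK.
      apply: le_trans (prU_le mu _ _).
      + apply: pr_le; [exact: measurableI|apply: measurableU; [exact: measurableI|exact: measurableD]|].
        move=> x [Ax Vx]; have [Bx|nBx] := pselect (B x); first by left.
        by right.
      + exact: measurableI.
      + exact: measurableD.
    have V1 := pr_le1 mu mV; have V0 := pr_ge0 mu V.
    rewrite -/m in ringAB ringAB0 h3.
    have h4 : (m - P B) * P V <= r * m by apply: le_trans ringAB; rewrite ler_piMr.
    rewrite ler_norml; lra.
  - exact: hshort.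
(* The shares are e/4 for fast returns, e/4 for n m, and e/2 for annulus and mixing together. *)
apply: le_trans h _.
have h5 := ler_wpM2r (ltW mp) nm.
have h6 : r * (1 + C') <= e / 2 by rewrite -ler_pdivlMr ?ltr_pwDl// ltW.
have h7 := ler_wpM2r (ltW mp) h6.
lra.
Unshelve. all: by end_near. Qed.

Lemma hitting_time_limits (x0 : X) (t : R) : 0 <= t ->
  (forall e, 0 < e -> \forall r \near 0^'+,
    0 < P (tube (f x0) r) <= e /\
    forall k, `|P (tube (f x0) r `&` survive (tube (f x0) r) k) -
       P (tube (f x0) r) * P (survive (tube (f x0) r) k)| <= e * P (tube (f x0) r)) ->
  (fun r : R => fine (mu [set x | (hit_time T f r x x0 >
                     (t / push mu f (eball (f x0) r))%:E)%E]))
    @ 0^'+ --> expR (- t)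
  /\
  (fun r : R => cond_meas mu (f @^-1` eball (f x0) r)
                  [set x | (hit_time T f r x x0 >
                     (t / push mu f (eball (f x0) r))%:E)%E])
    @ 0^'+ --> expR (- t).
Proof.
move=> t0 h; pose m r := P (tube (f x0) r).
pose S r := survive (tube (f x0) r) (Num.trunc (t / m r)).
have hS r : [set x | (hit_time T f r x x0 > (t / push mu f (eball (f x0) r))%:E)%E] = S r.
  by apply: survive_hit_time; rewrite divr_ge0// fine_ge0.
have glim : (fun r => (1 - m r) ^+ Num.trunc (t / m r)) @ 0^'+ --> expR (- t).
  by apply: geometric_limit => // e e0; apply: filterS (h e e0) => r [].
have slim : (fun r => P (S r)) @ 0^'+ --> expR (- t).
  apply/cvgrPdist_le => e e0; have e20 : 0 < e / 2 by rewrite divr_gt0.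
  near=> r.
  have h1 : `|expR (- t) - (1 - m r) ^+ Num.trunc (t / m r)| <= e / 2.
    by near: r; move/cvgrPdist_le : glim; apply.
  have [_ h2] : 0 < m r <= e / 2 /\ forall k, `|P (tube (f x0) r `&` survive (tube (f x0) r) k) -
       m r * P (survive (tube (f x0) r) k)| <= e / 2 * m r by near: r; exact: h.
  have h3 := survive_geometric (tube_measurable (f x0) r) (ltW e20) h2 (Num.trunc (t / m r)).
  rewrite -(subrKA ((1 - m r) ^+ Num.trunc (t / m r))) [leRHS]splitr.
  apply: le_trans (ler_normD _ _) _; apply: lerD h1 _.
  by rewrite distrC.
split; first by under eq_fun do rewrite hS.
under eq_fun do rewrite hS.
apply/cvgrPdist_le => e e0; have e20 : 0 < e / 2 by rewrite divr_gt0.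
near=> r.
have h1 : `|expR (- t) - P (S r)| <= e / 2.
  by near: r; move/cvgrPdist_le : slim; apply.
have [/andP[m0 _] /(_ (Num.trunc (t / m r))) h2] : 0 < m r <= e / 2 /\
     forall k, `|P (tube (f x0) r `&` survive (tube (f x0) r) k) -
       m r * P (survive (tube (f x0) r) k)| <= e / 2 * m r by near: r; exact: h.
rewrite -(subrKA (P (S r))) [leRHS]splitr.
apply: le_trans (ler_normD _ _) _; apply: lerD h1 _.
(* Divided by [m r], the decorrelation bound says that conditioning on the tube changes the survival
   probability by at most e/2. *)
rewrite distrC /cond_meas -[X in _ - X](mulfK (lt0r_neq0 m0)) -mulrBl normrM.
rewrite (ger0_norm (_ : 0 <= (m r)^-1)) ?invr_ge0 ?(ltW m0)//.
by rewrite ler_pdivrMr// [P (S r) * _]mulrC.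
Unshelve. all: by end_near. Qed.

Lemma hitting_time_law (t : R) : 0 <= t -> almost_aperiodic mu T f ->
  hypothesis_I mu f ->
  {ae mu, forall x0 : X, (0 < lower_dim mu f (f x0))%E ->
    (fun r : R => fine (mu [set x | (hit_time T f r x x0 >
                       (t / push mu f (eball (f x0) r))%:E)%E]))
      @ 0^'+ --> expR (- t)
    /\
    (fun r : R => cond_meas mu (f @^-1` eball (f x0) r)
                    [set x | (hit_time T f r x x0 >
                       (t / push mu f (eball (f x0) r))%:E)%E])
      @ 0^'+ --> expR (- t)}.
Proof.
move=> t0 aper [E [bE [muE hE]]].
have aeE : {ae mu, forall x, ~ E (f x)}.
  exists (f @^-1` E); split=> //; first exact: preim_eborel_measurable.
  by move=> x /= /contrapT.
(* D and K depend on x0, so the exceptional sets are united over these countably many values. *)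
have aeR : {ae mu, forall x0, forall D K : nat, (0 < D)%N -> enorm (f x0) + 1 <= K%:R ->
    (exists2 r1, 0 < r1 & forall r, 0 < r < r1 -> P (tube (f x0) r) ^+ D <= r) ->
    forall lam, 0 < lam -> exists2 r2, 0 < r2 & forall r n, 0 < r < r2 ->
      2 * r * n%:R ^+ (2 * D) <= 1 ->
      P (tube (f x0) r `&` ~` survive (tube (f x0) r) n) <=
        lam * P (tube (f x0) r)}.
  apply: ae_foralln => D; apply: ae_foralln => K.
  have [->|D0] := posnP D; first by apply: aeW.
  by apply: filterS (short_returns K D0 aper) => x hx _.
apply: filterS3 aeE aeR ball_measure_power_bound => x0 nE hR hlow dim0.
apply: hitting_time_limits => //.
have [a [b [a0 [b0 [r0 r00 hann]]]]] := hE _ nE.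
have [D D0 hD] := lower_dim_gt0 dim0.
pose K := (Num.trunc (enorm (f x0) + 1)).+1.
have hK : enorm (f x0) + 1 <= K%:R by apply: ltW; exact: truncnS_gt.
apply: (tube_decorrelation D0 a0 b0 hD hlow).
  by apply/near_right0P; exists r0 => // r rr0 rho; exact: hann.
move=> lam lam0; apply/near_right0P.
have [r2 r20 h2] := hR D K D0 hK ((near_right0P _).1 hD) lam lam0.
by exists r2 => // r hr n hn; exact: h2.
Qed.

End System.

Unset Implicit Arguments.

Theorem theorem2p4 (R : realType) (d : measure_display) (X : measurableType d)
  (dX : X -> X -> R) (mu : probability X R) (T : X -> X) (N : nat)
  (f : X -> 'rV[R]_N) :
  is_metric dX -> is_borel_of dX ->
  measure_preserving mu T ->
  superpoly_decay dX mu T ->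
  lipschitz_to_RN dX f ->
  almost_aperiodic mu T f ->
  hypothesis_I mu f ->
  forall t : R, 0 <= t ->
  {ae mu, forall x0 : X, (0 < lower_dim mu f (f x0))%E ->
    (fun r : R => fine (mu [set x | (hit_time T f r x x0 >
                       (t / push mu f (eball (f x0) r))%:E)%E]))
      @ 0^'+ --> expR (- t)
    /\
    (fun r : R => cond_meas mu (f @^-1` eball (f x0) r)
                    [set x | (hit_time T f r x x0 >
                       (t / push mu f (eball (f x0) r))%:E)%E])
      @ 0^'+ --> expR (- t)}.
Proof.
move=> dX_metric dX_borel T_mp decay f_lipschitz aper hypI t t0.
exact: (hitting_time_law dX_metric dX_borel f_lipschitz T_mp decay).
Qed.
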